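(* Let $k > \ell \geq 2$ be integers. There exists $t_0$ such that for every integer $t \geq t_0$ and every integer $n > \frac{1}{4}(t+1)^2\binom{t-1}{\ell-2} + 2t$, there exists an extremal $\ell$-graph on $n$ vertices (with respect to $k,\ell,t$, as defined in the context) that contains an isolated copy of $K^{\ell}_{t+1}$.
   Context: An $\ell$-graph $G$ is a pair $(V,E)$ with $V$ a finite set and $E$ a family of $\ell$-element subsets of $V$. A copy of $K^{\ell}_{s}$ in $G$ is an $s$-element set $S\subseteq V$ such that every $\ell$-subset of $S$ is an edge of $G$; a vertex $v$ is contained in the copy if $v\in S$. Given integers $k>\ell\ge 2$, $t$ and $n$, an $\ell$-graph $G$ on $n$ vertices is called extremal if every vertex of $G$ is contained in at least $\binom{t}{k-1}$ copies of $K^{\ell}_k$, and $G$ has the minimum number of edges among all $\ell$-graphs on $n$ vertices with this property. A copy $S$ of $K^\ell_{t+1}$ in $G$ is isolated if no edge of $G$ intersects both $S$ and $V\setminus S$. *)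

(* Defs.v *)
From mathcomp Require Import all_boot.

Set Implicit Arguments.
Unset Strict Implicit.
Unset Printing Implicit Defensive.

Record lgraph (l : nat) (V : finType) := LGraph {
  edges : {set {set V}};
  edges_card : forall e : {set V}, e \in edges -> #|e| = l
}.

(* Copies are vertex sets, hence counted unlabelled. *)
Definition is_copy (l : nat) (V : finType) (G : lgraph l V) (s : nat)
    (S : {set V}) : bool :=
  (#|S| == s) &&
  [forall e : {set V}, (e \subset S) && (#|e| == l) ==> (e \in edges G)].

Definition copies_at (l : nat) (V : finType) (G : lgraph l V) (s : nat)
    (v : V) : {set {set V}} :=
  [set S : {set V} | is_copy G s S & v \in S].

Definition covered (k l t : nat) (V : finType) (G : lgraph l V) : Prop :=
  forall v : V, 'C(t, k - 1) <= #|copies_at G k v|.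

Definition extremal (k l t n : nat) (V : finType) (G : lgraph l V) : Prop :=
  [/\ #|V| = n,
      covered k t G
    & forall (W : finType) (H : lgraph l W),
        #|W| = n -> covered k t H -> #|edges G| <= #|edges H| ].

Definition isolated_copy (l : nat) (V : finType) (G : lgraph l V) (s : nat)
    (S : {set V}) : Prop :=
  is_copy G s S /\
  forall e : {set V}, e \in edges G ->
    ~ (e :&: S != set0 /\ e :&: ~: S != set0).

(* Main.v *)
(* Let T = t + 1.  By Keevash's form of Kruskal-Katona a vertex lying in
   C(t, k-1) copies of K_k has degree at least C(t, l-1), and a "tight" vertex,
   for which equality holds, lies in a clique of order T containing all its
   edges.  Comparing an extremal graph G with a disjoint union of cliques of
   order T, the last two of which may overlap, bounds the excess of the degree
   sum and leaves more than 2t tight vertices.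

   Let U be the union of the T-cliques of the tight vertices.  If every vertex
   of U is tight, such a clique is isolated.  Otherwise |U| >= 2T, and G is
   rebuilt without gaining edges.  Inside U, put an isolated T-clique P and an
   economical union of T-cliques covering N = U \ P, one of which is called P'.
   For every nonempty R outside U, the trace on U of the edges e with
   e \ U = R is replaced by an initial segment of the colex order of the same
   size, for an order of the vertices in which P' comes first, then N \ P', then
   P.  These segments stay inside N because tight vertices meet no edge leaving
   U, so P is isolated.  A vertex w outside U stays covered: either it is joined
   to all of P', or the segment of R = {w} lies in P'; then every clique through
   w has a trace which spans edges automatically, and since initial segments are
   nested, Kruskal-Katona applied to a single R shows that the number of copies
   does not decrease. *)
Require Import Defs.
From mathcomp Require Import all_boot all_order all_algebra.
From mathcomp Require Import zify lra.
From Stdlib Require Import Classical_Prop.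

Set Implicit Arguments.
Unset Strict Implicit.
Unset Printing Implicit Defensive.

(** * Slices, cliques, links and deletions *)

Definition slice (V : finType) (U : {set V}) (r : nat) : {set {set V}} :=
  [set A : {set V} | A \subset U & #|A| == r].

Definition cliques (V : finType) (U : {set V}) (r j : nat)
    (F : {set {set V}}) : {set {set V}} :=
  [set C in slice U j | slice C r \subset F].

Definition link (V : finType) (i : V) (F : {set {set V}}) : {set {set V}} :=
  [set B : {set V} | (i \notin B) && (i |: B \in F)].

Definition deletion (V : finType) (i : V) (F : {set {set V}}) :
    {set {set V}} :=
  [set B in F | i \notin B].

Section Slices.

Variable V : finType.
Implicit Types (A B C U X : {set V}) (F : {set {set V}}).

Lemma in_slice U r A : (A \in slice U r) = (A \subset U) && (#|A| == r).
Proof. by rewrite inE. Qed.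

Lemma card_slice U r : #|slice U r| = 'C(#|U|, r).
Proof. exact: cards_draws. Qed.

Lemma slice_mono U X r : U \subset X -> slice U r \subset slice X r.
Proof.
move=> sUX; apply/subsetP=> A; rewrite !in_slice => /andP[sAU ->].
by rewrite (subset_trans sAU).
Qed.

Lemma slice_setI U X r : slice U r :&: slice X r = slice (U :&: X) r.
Proof.
by apply/setP=> A; rewrite !inE subsetI; case: (A \subset U); case: (A \subset X);
  case: (#|A| == r).
Qed.

Lemma ex_subset_card U c : c <= #|U| -> exists2 A : {set V}, A \subset U & #|A| = c.
Proof.
rewrite -bin_gt0 -card_slice card_gt0 => /set0Pn[A].
by rewrite in_slice => /andP[sAU /eqP cA]; exists A.
Qed.

Lemma ex_card_between A U c : A \subset U -> #|A| <= c -> c <= #|U| ->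
  exists B : {set V}, [/\ A \subset B, B \subset U & #|B| = c].
Proof.
move=> sAU leA leU.
have: c - #|A| <= #|U :\: A| by have := cardsID A U; rewrite (setIidPr sAU); lia.
case/ex_subset_card=> D sD cD; exists (A :|: D).
have dis: [disjoint A & D].
  rewrite disjoint_sym; apply: (disjointWl sD).
  by rewrite -setI_eq0 setIDAC setDIl setDv setI0.
split; [exact: subsetUl | |].
  by rewrite subUset sAU (subset_trans sD (subsetDl _ _)).
by rewrite cardsU (disjoint_setI0 dis) cards0 subn0 cD; lia.
Qed.

Lemma sub_slice_card U r F : F \subset slice U r -> #|F| <= 'C(#|U|, r).
Proof. by move=> /subset_leq_card; rewrite card_slice. Qed.

Lemma in_cliques U r j F C :
  (C \in cliques U r j F) =
  [&& C \subset U, #|C| == j & slice C r \subset F].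
Proof. by rewrite inE in_slice andbA. Qed.

Lemma cliques_sub U r j F : cliques U r j F \subset slice U j.
Proof. by apply/subsetP=> C; rewrite in_cliques in_slice => /and3P[-> -> _]. Qed.

Lemma cliques_lt U r j F : j < r -> cliques U r j F = slice U j.
Proof.
move=> ltjr; apply/setP=> C; rewrite in_cliques in_slice.
case: (C \subset U) => //=; case: eqP => //= cC.
apply/subsetP=> B; rewrite in_slice => /andP[/subset_leq_card sBC /eqP cB]; lia.
Qed.

Lemma cliques_diag U r F : F \subset slice U r -> cliques U r r F = F.
Proof.
move=> /subsetP sF; apply/setP=> C; rewrite in_cliques.
apply/and3P/idP => [[sCU cC /subsetP]|CF].
  by apply; rewrite in_slice subxx.
have := sF _ CF; rewrite in_slice => /andP[sCU cC]; split=> //.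
apply/subsetP=> B; rewrite in_slice => /andP[sBC /eqP cB].
suff -> : B = C by [].
by apply/eqP; rewrite eqEcard sBC cB (eqP cC) leqnn.
Qed.

(** For iterating a bound that raises the clique size by one: the j-cliques can serve as edges of a
    new family, as every r-set in [C] extends to a j-set in [C]. *)
Lemma cliques_step U r j F : r <= j ->
  cliques U j j.+1 (cliques U r j F) = cliques U r j.+1 F.
Proof.
move=> lerj; apply/setP=> C; rewrite !in_cliques.
case sCU: (C \subset U) => //=; case: eqP => //= cC.
apply/subsetP/subsetP => [h B|h B].
  rewrite in_slice => /andP[sBC /eqP cB].
  have [||D [sBD sDC cD]] := @ex_card_between _ _ j sBC; [by rewrite cB|by lia|].
  have := h D; rewrite in_slice sDC cD eqxx => /(_ isT); rewrite in_cliques.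
  by case/and3P=> _ _ /subsetP; apply; rewrite in_slice sBD cB eqxx.
rewrite in_slice in_cliques => /andP[sBC ->]; rewrite (subset_trans sBC sCU) /=.
apply/subsetP=> D; rewrite in_slice => /andP[sDB cD]; apply: h.
by rewrite in_slice (subset_trans sDB sBC).
Qed.

Lemma card_setU1S (i : V) B r : i \notin B -> (#|i |: B| == r.+1) = (#|B| == r).
Proof. by move=> iB; rewrite cardsU1 iB. Qed.

Lemma setU1_inj_notin (i : V) B C : i \notin B -> i \notin C ->
  i |: B = i |: C -> B = C.
Proof. by move=> iB iC e; rewrite -(setU1K iB) -(setU1K iC) e. Qed.

Lemma card_link (i : V) F : #|link i F| = #|[set A in F | i \in A]|.
Proof.
rewrite -(@card_in_imset _ _ (fun B => i |: B)) => [|B C]; last first.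
  by rewrite !inE => /andP[iB _] /andP[iC _]; apply: setU1_inj_notin.
apply: eq_card => A; apply/imsetP/idP => [[B]|].
  by rewrite !inE => /andP[iB BF] ->; rewrite BF setU11.
rewrite inE => /andP[AF iA]; exists (A :\ i); last by rewrite setD1K.
by rewrite inE setD11 setD1K.
Qed.

Lemma card_deletion_link (i : V) F : #|F| = #|deletion i F| + #|link i F|.
Proof.
rewrite card_link addnC -(cardsID [set A : {set V} | i \in A] F).
by congr (_ + _); apply: eq_card => A; rewrite !inE // andbC.
Qed.

Lemma deletion_sub (i : V) U r F : F \subset slice U r ->
  deletion i F \subset slice (U :\ i) r.
Proof.
move=> /subsetP sF; apply/subsetP=> A; rewrite inE => /andP[/sF].
by rewrite !in_slice subsetD1 => /andP[-> ->] ->.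
Qed.

Lemma link_sub (i : V) U r F : F \subset slice U r.+1 ->
  link i F \subset slice (U :\ i) r.
Proof.
move=> /subsetP sF; apply/subsetP=> A; rewrite inE => /andP[iA /sF].
rewrite !in_slice subsetD1 iA subUset card_setU1S // andbT.
by case/andP=> /andP[_ ->] ->.
Qed.

Lemma deletion_cliques (i : V) U r j F :
  deletion i (cliques U r j F) = cliques (U :\ i) r j (deletion i F).
Proof.
apply/setP=> C; rewrite inE !in_cliques subsetD1.
case iC: (i \in C); rewrite ?andbF //= !andbT; congr [&& _, _ & _].
apply/subsetP/subsetP=> h B Bs; last by have := h B Bs; rewrite inE => /andP[].
rewrite inE h //; apply/negP=> iB; move: Bs iC; rewrite in_slice => /andP[/subsetP s _].
by rewrite (s _ iB).
Qed.

(** An edge inside [i |: C] either avoids [i], a condition on the deletion, or is [i] added to a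
    subset of [C], a condition on the link. *)
Lemma link_cliques (i : V) U r j F : i \in U ->
  link i (cliques U r.+1 j.+1 F) =
  cliques (U :\ i) r.+1 j (deletion i F) :&: cliques (U :\ i) r j (link i F).
Proof.
move=> iU; apply/setP=> C; rewrite !inE !subsetD1 subUset sub1set iU /=.
case: (boolP (i \in C)) => iC; rewrite ?andbF //= andbT card_setU1S //.
case: (C \subset U) => //=; case: (#|C| == j) => //=.
apply/subsetP/andP=> [h|[/subsetP h1 /subsetP h2] B].
  split; apply/subsetP=> B; rewrite in_slice => /andP[sBC cB].
    rewrite inE h ?in_slice ?cB ?andbT ?(subset_trans sBC (subsetUr _ _)) //=.
    by apply: contra iC; apply: (subsetP sBC).
  have iB: i \notin B by apply: contra iC; apply: (subsetP sBC).
  by rewrite inE iB h // in_slice setUS ?card_setU1S.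
rewrite in_slice => /andP[sB cB]; case: (boolP (i \in B)) => iB.
  have := h2 (B :\ i); rewrite in_slice subDset sB inE setD11 setD1K //=.
  by apply; move: cB; rewrite (cardsD1 i B) iB.
have sBC: B \subset C.
  by apply/subsetP=> x xB; have := subsetP sB _ xB; rewrite in_setU1;
    case: eqP => // e; rewrite -e xB in iB.
by have := h1 B; rewrite in_slice sBC cB => /(_ isT); rewrite inE => /andP[].
Qed.

Lemma sum_card_link U r F : F \subset slice U r ->
  \sum_(i in U) #|link i F| = r * #|F|.
Proof.
move=> /subsetP sF.
under eq_bigr => i _ do rewrite card_link -sum1_card big_mkcond /=.
rewrite exchange_big /= mulnC -sum_nat_const [RHS]big_mkcond /=.
apply: eq_bigr => A _; case: ifP => AF; last first.
  by rewrite big1 // => i _; rewrite inE AF.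
have := sF _ AF; rewrite in_slice => /andP[/setIidPr sAU /eqP <-].
rewrite -sum1_card -[in RHS]sAU big_mkcond [in RHS]big_mkcond /=.
by apply: eq_bigr => i _; rewrite !inE AF; case: (i \in U).
Qed.

End Slices.

(** * Graphs with few edges have few cliques *)

Section CliqueBound.

Variable V : finType.
Implicit Types (A B C U X : {set V}) (E F : {set {set V}}).

Lemma slice1_eq U F : F \subset slice U 1 ->
  F = slice [set i | [set i] \in F] 1.
Proof.
move=> /subsetP sF; apply/setP=> A; rewrite in_slice.
apply/idP/andP=> [AF|[sA /cards1P[i eA]]].
  have := sF _ AF; rewrite in_slice => /andP[_ cA]; split=> //.
  by have /cards1P[i eA] := cA; rewrite eA sub1set inE -eA.
by move: sA; rewrite eA sub1set inE.
Qed.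

(** Here [d] is the degree of a vertex, [c] the number of cliques through it and [f] the number of
    edges. If [d] exceeds ['C(t.-1, r)], Pascal's rule leaves [c < 'C(t.-1, r.+1)]. *)
Lemma leq_mul2_link_bound t r c d f :
  0 < r -> r < t -> f <= 'C(t, r.+1) -> 'C(t.-1, r) < d -> c + d <= f ->
  r.+1 * c < (t - r.+1) * d.
Proof.
case: t => // t; case: r => // r _ ltrt; rewrite /= binS => le_f lt_d le_cd.
have := mul_bin_left t r.+1; nia.
Qed.

Lemma slice_subset U X r : 0 < r <= #|X| ->
  slice X r \subset slice U r -> X \subset U.
Proof.
case/andP=> r0 rX /subsetP s; apply/subsetP=> x xX.
have [|||B [xB sB cB]] := @ex_card_between _ [set x] X r; rewrite ?sub1set ?cards1 //.
have := s B; rewrite !in_slice sB cB eqxx => /(_ isT) /andP[sBU _].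
by rewrite (subsetP sBU) // -sub1set.
Qed.

(* Keevash's proof of the Lovasz form of Kruskal-Katona: a clique through a
   vertex is determined both by a clique of the link and by the edge opposite
   to the vertex; the first bound serves the vertices of small degree, the
   second one the others. *)
Lemma card_cliques_up r U t F :
  F \subset slice U r.+1 -> #|F| <= 'C(t, r.+1) -> r.+1 < t ->
  r.+2 * #|cliques U r.+1 r.+2 F| <= (t - r.+1) * #|F| /\
  (F != set0 -> r.+2 * #|cliques U r.+1 r.+2 F| = (t - r.+1) * #|F| ->
    exists2 X : {set V}, #|X| = t & F = slice X r.+1).
Proof.
elim: r U t F => [|r IHr] U t F sF leF ltrt.
  have eF := slice1_eq sF; set Y := [set i | [set i] \in F] in eF.
  have cF : #|F| = #|Y| by rewrite eF card_slice bin1.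
  have sK : cliques U 1 2 F \subset slice Y 2.
    apply/subsetP=> C; rewrite in_cliques in_slice => /and3P[_ cC].
    rewrite cC andbT {1}eF; apply: slice_subset.
    by rewrite (eqP cC).
  have leK := sub_slice_card sK; have b2 := mul_bin_left #|Y| 1.
  rewrite bin1 in leF; rewrite bin1 in b2; rewrite cF in leF *.
  split=> [|F0 eqK].
    apply: (@leq_trans (2 * 'C(#|Y|, 2))); first by rewrite leq_mul2l leK orbT.
    by rewrite b2 leq_mul2r leq_sub2r ?orbT.
  have Y0 : 0 < #|Y| by rewrite -cF card_gt0.
  have : (t - 1) * #|Y| <= (#|Y| - 1) * #|Y| by rewrite -eqK -b2 leq_mul2l leK orbT.
  by rewrite leq_pmul2r // => le_t; exists Y => //; lia.
set K := cliques U r.+2 r.+3 F.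
have linkK i : i \in U -> link i K =
    deletion i F :&: cliques (U :\ i) r.+1 r.+2 (link i F).
  by move=> iU; rewrite /K link_cliques // cliques_diag // deletion_sub.
have small i : i \in U -> #|link i F| <= 'C(t.-1, r.+1) ->
    r.+2 * #|cliques (U :\ i) r.+1 r.+2 (link i F)| <= (t - r.+2) * #|link i F|.
  move=> iU led; have [|le _] := IHr (U :\ i) t.-1 (link i F) (link_sub i sF) led.
    by lia.
  by have -> : t - r.+2 = t.-1 - r.+1 by lia.
have big i : i \in U -> 'C(t.-1, r.+1) < #|link i F| ->
    r.+2 * #|link i K| < (t - r.+2) * #|link i F|.
  move=> iU ltd; apply: (@leq_mul2_link_bound t r.+1 _ _ #|F|) => //; first by lia.
  rewrite (card_deletion_link i F) leq_add2r.
  by rewrite linkK // subset_leq_card ?subsetIl.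
have local i : i \in U -> r.+2 * #|link i K| <= (t - r.+2) * #|link i F|.
  move=> iU; case: (leqP #|link i F| 'C(t.-1, r.+1)) => [led|/(big _ iU)/ltnW//].
  apply: leq_trans (small _ iU led); rewrite leq_mul2l linkK //.
  by rewrite subset_leq_card ?subsetIr.
have sumK : r.+2 * (r.+3 * #|K|) = \sum_(i in U) r.+2 * #|link i K|.
  by rewrite -(sum_card_link (cliques_sub U r.+2 r.+3 F)) big_distrr.
have sumF : (t - r.+2) * (r.+2 * #|F|) = \sum_(i in U) (t - r.+2) * #|link i F|.
  by rewrite -(sum_card_link sF) big_distrr.
split=> [|/set0Pn[A AF] eqK].
  have : r.+2 * (r.+3 * #|K|) <= (t - r.+2) * (r.+2 * #|F|).
    by rewrite sumK sumF; apply: leq_sum.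
  by rewrite (mulnCA (t - r.+2)) leq_pmul2l.
have := subsetP sF _ AF; rewrite in_slice => /andP[sAU /eqP cA].
have /card_gt0P[i iA] : 0 < #|A| by rewrite cA.
have iU := subsetP sAU _ iA.
have d0 : link i F != set0.
  by apply/set0Pn; exists (A :\ i); rewrite inE setD11 setD1K.
(* Equality in the sum forces equality at [i]. As [big] is strict, the degree of [i] is then small,
   and the equality case of the induction hypothesis describes its link. *)
have eq_i : r.+2 * #|link i K| = (t - r.+2) * #|link i F|.
  apply/eqP; rewrite eqn_leq local //= leqNgt; apply/negP=> lt_i.
  have: r.+2 * (r.+3 * #|K|) < (t - r.+2) * (r.+2 * #|F|).
    rewrite sumK sumF (bigD1 i) //= [ltnRHS](bigD1 i) //= -addSn leq_add //.
    by apply: leq_sum => j /andP[jU _]; apply: local.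
  by rewrite (mulnCA (t - r.+2)) ltn_pmul2l // eqK ltnn.
have led : #|link i F| <= 'C(t.-1, r.+1).
  by rewrite leqNgt; apply/negP=> /(big _ iU); rewrite eq_i ltnn.
have leK : #|link i K| <= #|cliques (U :\ i) r.+1 r.+2 (link i F)|.
  by rewrite linkK // subset_leq_card ?subsetIr.
have eqc : #|link i K| = #|cliques (U :\ i) r.+1 r.+2 (link i F)|.
  by have := small _ iU led; nia.
have [|_ []//] := IHr (U :\ i) t.-1 (link i F) (link_sub i sF) led; first by lia.
  by rewrite -eqc eq_i; congr (_ * _); lia.
move=> X cX eX; exists (i |: X).
all: have sXU : X \subset U :\ i.
  1,3: apply: (@slice_subset _ _ r.+1); [lia | by rewrite -eX; apply: link_sub].
all: have iX : i \notin X by apply/negP=> /(subsetP sXU); rewrite setD11.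
  by rewrite cardsU1 iX cX; lia.
(* By the size bound on [F], an inclusion suffices. Subsets of [i |: X] through [i] come from the
   link; those avoiding [i] are cliques of the link, which by [eqc] all belong to [link i K] and
   hence to [F]. *)
apply/eqP; rewrite eq_sym eqEcard card_slice cardsU1 iX cX; apply/andP; split; last first.
  by apply: leq_trans leF _; apply: leq_bin2l; lia.
apply/subsetP=> B; rewrite in_slice => /andP[sB cB]; case: (boolP (i \in B)) => iB.
  have : B :\ i \in link i F.
    rewrite eX in_slice subDset sB /=; move: cB.
    by rewrite (cardsD1 i B) iB.
  by rewrite inE setD1K // => /andP[].
have sBX : B \subset X by rewrite -(setU1K iX) subsetD1 sB.
have : B \in link i K.
  have -> : link i K = cliques (U :\ i) r.+1 r.+2 (link i F).
    by apply/eqP; rewrite eqEcard eqc leqnn linkK // subsetIr.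
  by rewrite in_cliques eX (subset_trans sBX sXU) cB slice_mono.
by rewrite linkK // inE => /andP[]; rewrite inE => /andP[].
Qed.

(** A deficit below ['C(t, i)] at one clique size persists at all larger sizes up to [t], so none
    can occur at size [r]. When [F] has exactly ['C(t, r)] members, none occurs at the next size
    either, which is equality in [card_cliques_up]. *)
Lemma card_cliques_bound r j U t F :
  F \subset slice U r -> 0 < r -> r < j <= t ->
  'C(t, j) <= #|cliques U r j F| ->
  'C(t, r) <= #|F| /\
  (#|F| = 'C(t, r) -> exists2 X : {set V}, #|X| = t & F = slice X r).
Proof.
move=> sF r0 /andP[ltrj lejt] leK.
pose K i := cliques U r i F.
have up i : r <= i < t -> #|K i| <= 'C(t, i) -> i.+1 * #|K i.+1| <= (t - i) * #|K i|.
  case: i => [|i] /andP[leri ltit] leKi; first by lia.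
  have [] := card_cliques_up (cliques_sub U r i.+1 F) leKi ltit.
  by rewrite cliques_step.
have weak i : r <= i < t -> #|K i| <= 'C(t, i) -> #|K i.+1| <= 'C(t, i.+1).
  move=> hi leKi; rewrite -(@leq_pmul2l i.+1) // mul_bin_left.
  by apply: leq_trans (up i hi leKi) _; rewrite leq_mul2l leKi orbT.
have strict d i : r <= i -> i + d <= t -> #|K i| < 'C(t, i) ->
    #|K (i + d)| < 'C(t, i + d).
  move=> leri; elim: d => [|d IHd] led ltK; first by rewrite addn0.
  have {IHd ltK} ltK : #|K (i + d)| < 'C(t, i + d) by apply: IHd => //; lia.
  rewrite addnS -(@ltn_pmul2l (i + d).+1) // mul_bin_left.
  apply: leq_ltn_trans (up _ _ (ltnW ltK)) _; first by lia.
  by rewrite ltn_pmul2l //; lia.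
have KrF : K r = F by apply: cliques_diag.
split=> [|cF].
  rewrite leqNgt; apply/negP=> ltF.
  have := @strict (j - r) r (leqnn r); rewrite KrF subnKC; last exact: ltnW.
  by move=> /(_ lejt ltF); rewrite ltnNge leK.
case: r r0 => // r _ in sF ltrj leK K up weak strict KrF cF *.
have [||_ eqX] := @card_cliques_up r U t F sF; [by rewrite cF|by lia|].
apply: eqX; first by rewrite -card_gt0 cF bin_gt0; lia.
have le1 := up r.+1; rewrite KrF cF leqnn leqnn in le1.
apply/eqP; rewrite eqn_leq cF le1 //=; last by lia.
rewrite leqNgt -mul_bin_left ltn_pmul2l //; apply/negP=> ltF.
have := @strict (j - r.+2) r.+2 (leqnSn _); rewrite subnKC //.
by move=> /(_ lejt ltF); rewrite ltnNge leK.
Qed.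

Lemma link_cliques_bound l k t E (v : V) :
  0 < l < k -> k <= t -> E \subset slice setT l.+1 ->
  'C(t, k) <= #|link v (cliques setT l.+1 k.+1 E)| ->
  'C(t, l) <= #|link v E| /\
  (#|link v E| = 'C(t, l) ->
   exists Q : {set V}, [/\ v \in Q, #|Q| = t.+1, slice Q l.+1 \subset E
                         & forall e, e \in E -> v \in e -> e \subset Q]).
Proof.
case/andP=> l0 ltlk lekt sE; rewrite link_cliques ?inE // => leK.
have sL := link_sub v sE.
have leK2 : 'C(t, k) <= #|cliques (setT :\ v) l k (link v E)|.
  by apply: leq_trans leK _; rewrite subset_leq_card ?subsetIr.
have [|leL eqL] := card_cliques_bound sL l0 _ leK2; first by rewrite ltlk.
split=> // /eqL[X cX eX].
have sXv : X \subset setT :\ v.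
  by apply: (@slice_subset _ _ l); rewrite -?eX // l0 cX; lia.
have vX : v \notin X by apply/negP=> /(subsetP sXv); rewrite setD11.
have sK : cliques (setT :\ v) l k (link v E) \subset slice X k.
  apply/subsetP=> C; rewrite in_cliques in_slice => /and3P[_ cC].
  rewrite cC andbT eX; apply: slice_subset.
  by rewrite (eqP cC) l0 ltnW.
(* There is no slack: the intersection has at least ['C(t, k)] members and lies in [slice X k], so
   the two agree and every k-subset of [X] spans a clique in [E]. *)
have sX : slice X k \subset cliques (setT :\ v) l.+1 k (deletion v E).
  set I := _ :&: _ in leK.
  have -> : slice X k = I.
    apply/eqP; rewrite eq_sym eqEcard card_slice cX leK andbT.
    by apply: subset_trans sK; apply: subsetIr.
  exact: subsetIl.
exists (v |: X); split; rewrite ?setU11 ?cardsU1 ?vX ?cX //.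
  apply/subsetP=> e; rewrite in_slice => /andP[se ce]; case: (boolP (v \in e)) => ve.
    have : e :\ v \in link v E.
      rewrite eX in_slice subDset se /=; move: ce.
      by rewrite (cardsD1 v e) ve.
    by rewrite inE setD1K // => /andP[].
  have seX : e \subset X by rewrite -(setU1K vX) subsetD1 se.
  have [||B [seB sBX cB]] := @ex_card_between _ e X k seX; rewrite ?(eqP ce) ?cX //.
  have /(subsetP sX) : B \in slice X k by rewrite in_slice sBX cB eqxx.
  rewrite in_cliques => /and3P[_ _ /subsetP/(_ e)].
  by rewrite in_slice seB ce inE => /(_ isT) /andP[].
move=> e eE ve; rewrite -subDset.
have : e :\ v \in link v E by rewrite inE setD11 setD1K.
by rewrite eX in_slice => /andP[].
Qed.

End CliqueBound.

(** * Initial segments of the colexicographic order *)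

Section Colex.

Variables (V : finType) (rk : V -> nat).
Hypothesis rk_inj : injective rk.
Implicit Types (A B C U X : {set V}) (F I J : {set {set V}}).

(** Binary encoding: the element of largest rank in which two sets differ decides the comparison, so
    the order by weight is the colexicographic order. *)
Definition weight A := \sum_(i in A) 2 ^ rk i.

Definition initial U r I :=
  I \subset slice U r /\
  forall A B, A \in slice U r -> B \in I -> weight A <= weight B -> A \in I.

Lemma sum_rk_lt A n : \sum_(i in A | rk i < n) 2 ^ rk i < 2 ^ n.
Proof.
elim: n => [|n IHn]; first by rewrite big1 // => i; rewrite andbF.
rewrite (bigID (fun i => rk i == n)) /= expnS mul2n -addnn addnC -addSn leq_add //.
  apply: leq_ltn_trans IHn; rewrite leq_eqVlt; apply/orP; left; apply/eqP.
  by apply: eq_bigl => i; rewrite -andbA; congr (_ && _); lia.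
case: (pickP (fun i => (i \in A) && (rk i < n.+1) && (rk i == n))) => [m hm|h0].
  rewrite (bigD1 m) //= big1 ?addn0; first by case/andP: hm => _ /eqP->.
  move=> i /andP[/andP[_ /eqP ei] /eqP ne]; case: ne; apply: rk_inj.
  by case/andP: hm => _ /eqP->.
by rewrite big_pred0.
Qed.

Lemma weight_lt A B m : m \in B -> m \notin A ->
  (forall x, rk m < rk x -> (x \in A) = (x \in B)) -> weight A < weight B.
Proof.
move=> mB mA eqAB; rewrite /weight.
rewrite (bigID (fun i => rk i < rk m)) /= [ltnRHS](bigID (fun i => rk i < rk m)) /=.
rewrite [X in _ < _ + X](bigD1 m) /=; last by rewrite mB ltnn.
rewrite addnA; set S := \sum_(i in A | ~~ _) _; set S' := \sum_(_ | _ && (_ != _)) _.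
have -> : S = S'.
  apply: eq_bigl => i; case: (ltngtP (rk i) (rk m)) => /= h; rewrite ?andbF ?andbT //.
    rewrite eqAB //; case: eqP => // e; first by rewrite e ltnn in h.
    by rewrite andbT.
  by rewrite (rk_inj h) ?(negbTE mA) ?eqxx ?andbF.
rewrite ltn_add2r; apply: leq_trans (sum_rk_lt A (rk m)) _.
exact: leq_addl.
Qed.

Lemma weight_ltP A B : weight A <= weight B -> A != B ->
  exists m, [/\ m \in B, m \notin A
              & forall x, rk m < rk x -> (x \in A) = (x \in B)].
Proof.
move=> leAB neAB.
have [m0 hm0] : exists m, (m \in A) != (m \in B).
  apply/existsP; rewrite -negb_forall; apply: contra neAB => /forallP h.
  by apply/eqP/setP=> x; apply/eqP.
case: (@arg_maxnP V m0 (fun x => (x \in A) != (x \in B)) rk hm0) => m hm maxm.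
have agree x : rk m < rk x -> (x \in A) = (x \in B).
  by move=> ltx; apply/eqP; apply: contraLR ltx => /maxm; rewrite -leqNgt.
exists m; case mB: (m \in B) hm; case mA: (m \in A) => // _.
have := @weight_lt B A m mA; rewrite mB ltnNge leAB.
by move=> /(_ isT) h; suff: false by []; apply: h => x /agree.
Qed.

Lemma weight_inj A B : weight A = weight B -> A = B.
Proof.
move=> e; apply/eqP; apply/negPn/negP=> ne.
have [|m [mB mA eqAB]] := @weight_ltP A B _ ne; first by rewrite e.
by have := weight_lt mB mA eqAB; rewrite e ltnn.
Qed.

Lemma weightU1 i A : i \notin A -> weight (i |: A) = 2 ^ rk i + weight A.
Proof. by move=> iA; rewrite /weight big_setU1. Qed.

Lemma initial_nested U r I J : initial U r I -> initial U r J ->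
  #|I| <= #|J| -> I \subset J.
Proof.
move=> [sI hI] [sJ hJ] le; apply/subsetP=> A AI; apply/negPn/negP=> AJ.
have sJI : J \subset I.
  apply/subsetP=> B BJ; apply: (hI B A) => //; first exact: (subsetP sJ).
  rewrite leqNgt; apply/negP=> /ltnW lt; case/negP: AJ.
  by apply: (hJ A B) => //; apply: (subsetP sI).
have : J \proper I by rewrite properE sJI; apply/subsetPn; exists A.
by move=> /proper_card; rewrite ltnNge le.
Qed.

Lemma initial_uniq U r I J : initial U r I -> initial U r J ->
  #|I| = #|J| -> I = J.
Proof.
by move=> iI iJ e; apply/eqP; rewrite eqEsubset !(@initial_nested U r) ?e.
Qed.

Lemma initial0 U r : initial U r set0.
Proof. by split=> [|A B _]; rewrite ?sub0set ?inE. Qed.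

Lemma ex_initial U r n : n <= 'C(#|U|, r) -> exists2 I, initial U r I & #|I| = n.
Proof.
elim: n => [|n IHn] len; first by exists set0; [apply: initial0|rewrite cards0].
have [I [sI hI] cI] := IHn (ltnW len).
have /set0Pn[A0 hA0] : slice U r :\: I != set0.
  by rewrite -card_gt0; have := cardsID I (slice U r); rewrite card_slice (setIidPr sI); lia.
case: (@arg_minnP _ A0 (fun A => A \in slice U r :\: I) weight hA0) => A.
rewrite in_setD => /andP[AI As] minA.
exists (A |: I); last by rewrite cardsU1 AI cI.
split=> [|B C Bs]; first by rewrite subUset sub1set As.
rewrite !in_setU1 => /orP[/eqP->|CI] leBC; last by rewrite (hI B C) ?orbT.
case BI: (B \in I); rewrite ?orbT // orbF; apply/eqP/weight_inj.
by apply/eqP; rewrite eqn_leq leBC minA // in_setD BI.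
Qed.

(** Every member of [F :\: I] outweighs every member of [I]. The strict inequality makes the total
    weight a termination measure for compressions. *)
Lemma initial_sum_lt U r I F : initial U r I -> F \subset slice U r ->
  #|I| = #|F| -> F != I -> \sum_(A in I) weight A < \sum_(A in F) weight A.
Proof.
move=> [sI hI] sF cIF neFI.
rewrite (big_setID F) /= [ltnRHS](big_setID I) /= setIC ltn_add2l.
pose M := \max_(A in I) weight A.
have cD : #|I :\: F| = #|F :\: I|.
  by have := cardsID F I; have := cardsID I F; rewrite setIC; lia.
have D0 : 0 < #|F :\: I|.
  rewrite card_gt0 setD_eq0; apply: contra neFI => sFI.
  by rewrite eqEcard sFI cIF leqnn.
have up : \sum_(A in I :\: F) weight A <= #|F :\: I| * M.
  rewrite -cD -sum_nat_const; apply: leq_sum => A; rewrite inE => /andP[_ AI].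
  by rewrite /M (bigD1 A) //= leq_maxl.
apply: leq_ltn_trans up _.
apply: (@leq_trans (#|F :\: I| * M.+1)); first by rewrite ltn_pmul2l.
rewrite -sum_nat_const; apply: leq_sum => B; rewrite inE => /andP[BI BF].
have I0 : 0 < #|I|.
  have := cardsID F I; rewrite cD; lia.
rewrite /M; have [A AI ->] := @eq_bigmax_cond _ (mem I) weight I0.
rewrite ltnNge; apply/negP=> le; case/negP: BI; apply: (hI B A) => //.
exact: (subsetP sF).
Qed.

(** Let [m] be the top difference of [C] and a later clique [C']. An r-subset [B] of [C] either lies
    in [C'] or precedes an r-subset of [C'] through [m]; in both cases [B] is in [I]. *)
Lemma initial_cliques U r j I : initial U r I -> initial U j (cliques U r j I).
Proof.
move=> [sI hI]; split=> [|C C' Cs]; first exact: cliques_sub.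
case: (eqVneq C C') => [-> //|ne] C'K le.
have [m [mC' mC agree]] := weight_ltP le ne.
move: C'K Cs; rewrite !in_cliques in_slice => /and3P[sC'U cC' /subsetP hC'] /andP[sCU cC].
rewrite sCU cC; apply/subsetP=> B; rewrite in_slice => /andP[sBC cB].
have mB : m \notin B by apply: contra mC; apply: (subsetP sBC).
have Bs : B \in slice U r by rewrite in_slice (subset_trans sBC).
pose hi X := [set x in X | rk m < rk x]; pose lo X := [set x in X | rk x < rk m].
have split_hl X : m \notin X -> #|X| = #|hi X| + #|lo X|.
  move=> mX; rewrite -(cardsID (hi setT) X); congr (_ + _); apply: eq_card => x.
    by rewrite !inE andbC.
  rewrite !inE /=; case xX: (x \in X); rewrite ?andbF //= andbT -leqNgt leq_eqVlt.
  by case: eqP => // /rk_inj ex; rewrite -ex xX in mX.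
have hiC : hi C = hi C'.
  by apply/setP=> x; rewrite !inE; case: ltnP => h; rewrite ?andbF // agree.
have loC : #|lo C| = #|lo C'|.+1.
  have eqC' : #|C' :\ m| = #|hi C'| + #|lo C'|.
    rewrite split_hl ?setD11 //; congr (_ + _); apply: eq_card => x; rewrite !inE;
      by case: eqP => // ->; rewrite ltnn !andbF.
  by have := cardsD1 m C'; have := split_hl C mC; rewrite hiC mC'; lia.
have hiBC : hi B \subset hi C.
  by apply/subsetP=> x; rewrite !inE => /andP[/(subsetP sBC)-> ->].
have hiBC' : hi B \subset C'.
  by rewrite hiC in hiBC; apply: subset_trans hiBC _;
    apply/subsetP=> x; rewrite inE => /andP[].
have [lo0|lo1] := posnP #|lo B|.
  apply: hC'; rewrite in_slice cB andbT.
  suff -> : B = hi B by [].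
  by apply/eqP; rewrite eq_sym eqEcard (split_hl B mB) lo0 addn0 leqnn andbT;
    apply/subsetP=> x; rewrite inE => /andP[].
have loBC : #|lo B| <= #|lo C|.
  by apply: subset_leq_card; apply/subsetP=> x; rewrite !inE => /andP[/(subsetP sBC)-> ->].
have [|D sD cD] := @ex_subset_card _ (lo C') #|lo B|.-1; first by lia.
(* [B'] keeps the part of [B] above [m], takes [m], and is filled up with elements of [C'] below
   [m]. There are enough of these, since [lo C] has just one element more than [lo C']. *)
pose B' := m |: (hi B :|: D).
have dis : hi B :&: D = set0.
  apply/setP=> x; rewrite !inE; apply/negP=> /andP[/andP[_ h1] /(subsetP sD)].
  by rewrite inE => /andP[_ h2]; have := ltn_trans h1 h2; rewrite ltnn.
have mhD : m \notin hi B :|: D.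
  rewrite !inE ltnn andbF /=; apply/negP=> /(subsetP sD); rewrite inE ltnn andbF //.
have B'I : B' \in I.
  apply: hC'; rewrite in_slice !subUset sub1set mC' hiBC' /=; apply/andP; split.
    by apply: subset_trans sD _; apply/subsetP=> x; rewrite inE => /andP[].
  by rewrite cardsU1 mhD cardsU dis cards0 subn0 cD -(eqP cB) (split_hl B mB) add1n -addnS prednK.
apply: (hI B B') => //; apply: ltnW; apply: (@weight_lt B B' m) => //.
  by rewrite setU11.
move=> x ltx; rewrite !inE ltx andbT.
case: eqP => [ex|_]; first by rewrite ex ltnn in ltx.
case: (boolP (x \in D)) => [/(subsetP sD)|]; last by rewrite orbF.
by rewrite inE => /andP[_ h2]; have := ltn_trans ltx h2; rewrite ltnn.
Qed.

End Colex.

(** * The Kruskal-Katona theorem *)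

Section KruskalKatona.

Variables (V : finType) (rk : V -> nat).
Hypothesis rk_inj : injective rk.
Implicit Types (A B C U X : {set V}) (F I J : {set {set V}}).
Local Notation weight := (weight rk).
Local Notation initial := (initial rk).

Lemma sum_deletion_link (i : V) F (f : {set V} -> nat) :
  \sum_(A in F) f A =
  \sum_(A in deletion i F) f A + \sum_(A in link i F) f (i |: A).
Proof.
rewrite (bigID (fun A => i \in A)) /= addnC; congr (_ + _).
  by apply: eq_bigl => A; rewrite inE.
rewrite (reindex_onto (fun A => i |: A) (fun A => A :\ i)) /=; last first.
  by move=> A /andP[_ iA]; rewrite setD1K.
apply: eq_bigl => A; rewrite !inE eqxx andbT andbC; congr (_ && _).
by apply/eqP/idP => [<-|iA]; rewrite ?setD11 ?setU1K.
Qed.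

Definition glue (i : V) (I0 I1 : {set {set V}}) : {set {set V}} :=
  [set A : {set V} | if i \in A then A :\ i \in I1 else A \in I0].

Section Glue.

Variables (i : V) (U : {set V}) (r : nat) (I0 I1 : {set {set V}}).
Hypothesis iU : i \in U.
Hypothesis sI0 : I0 \subset slice (U :\ i) r.+1.
Hypothesis sI1 : I1 \subset slice (U :\ i) r.

Lemma deletion_glue : deletion i (glue i I0 I1) = I0.
Proof.
apply/setP=> A; rewrite !inE; case: ifP => iA; rewrite ?andbF ?andbT //.
apply/esym/negP=> /(subsetP sI0); rewrite in_slice => /andP[/subsetP/(_ i iA)].
by rewrite setD11.
Qed.

Lemma link_glue : link i (glue i I0 I1) = I1.
Proof.
apply/setP=> A; rewrite !inE eqxx /=; case: (boolP (i \in A)) => iA /=.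
  apply/esym/negP=> /(subsetP sI1); rewrite in_slice => /andP[/subsetP/(_ i iA)].
  by rewrite setD11.
by rewrite setU1K.
Qed.

Lemma glue_sub : glue i I0 I1 \subset slice U r.+1.
Proof.
apply/subsetP=> A; rewrite inE in_slice; case: ifP => iA.
  move=> /(subsetP sI1); rewrite in_slice subsetD1 => /andP[/andP[sA _]].
  rewrite (cardsD1 i A) iA add1n eqSS => ->; rewrite andbT.
  by rewrite -(setD1K iA) subUset sub1set iU sA.
move=> /(subsetP sI0); rewrite in_slice subsetD1 => /andP[/andP[sA _]] ->.
by rewrite sA.
Qed.

End Glue.

(* A stable family F is an initial segment, up to replacing the last member A of
   the segment by its successor B, which must then be the complement of A. *)
Lemma stable_cliques U r j F I :
  F \subset slice U r.+1 ->
  (forall i, i \in U -> initial (U :\ i) r.+1 (deletion i F)) ->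
  (forall i, i \in U -> initial (U :\ i) r (link i F)) ->
  initial U r.+1 I -> #|I| = #|F| -> r.+1 < j ->
  cliques U r.+1 j F \subset cliques U r.+1 j I.
Proof.
move=> sF hdel hlnk hI cIF ltrj.
case: (boolP [exists A in slice U r.+1, exists B in F,
               (weight A <= weight B) && (A \notin F)]); last first.
  rewrite negb_exists_in => /forall_inP h.
  suff iF : initial U r.+1 F by rewrite (initial_uniq hI iF cIF).
  split=> // A B As BF le; move: (h A As); rewrite negb_exists_in.
  by move=> /forall_inP/(_ B BF); rewrite le negbK.
move=> /exists_inP[A As /exists_inP[B BF /andP[leAB AF]]].
(* If [Y] and [Z] agreed at some [i] of [U], both would be visible in the link or both in the
   deletion at [i], and initiality there would put [Y] into [F]. *)
have swap Y Z : Y \in slice U r.+1 -> Z \in F -> weight Y <= weight Z ->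
    Y \notin F -> Z = U :\: Y.
  move=> Ys ZF le YF; apply/setP=> i; rewrite inE.
  have := subsetP sF _ ZF; rewrite in_slice => /andP[sZU cZ].
  move: (Ys); rewrite in_slice => /andP[sYU cY].
  case: (boolP (i \in U)) => iU; last first.
    by rewrite andbF; apply/negbTE; apply: contra iU; apply: (subsetP sZU).
  rewrite andbT; case: (boolP (i \in Y)) => iY; case: (boolP (i \in Z)) => iZ //=.
    have [_ hl] := hlnk i iU; case/negP: YF; rewrite -(setD1K iY).
    have : Y :\ i \in link i F.
      apply: (hl _ (Z :\ i)).
      - by rewrite in_slice setSD //=; move: cY; rewrite (cardsD1 i Y) iY.
      - by rewrite inE setD11 setD1K.
      by move: le; rewrite -{1}(setD1K iY) -{1}(setD1K iZ) !weightU1 ?setD11 // leq_add2l.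
    by rewrite inE setD11.
  have [_ hd] := hdel i iU; case/negP: YF.
  have : Y \in deletion i F.
    apply: (hd _ Z) => //; last by rewrite inE ZF.
    by rewrite in_slice subsetD1 sYU iY.
  by rewrite inE => /andP[].
have eBA : B = U :\: A by apply: swap.
have neAB : A != B by apply: contra AF => /eqP->.
have [m [mB mA agree]] := weight_ltP rk_inj leAB neAB.
have ltAB := weight_lt rk_inj mB mA agree.
have compl (Y : {set V}) : Y \subset U -> U :\: (U :\: Y) = Y.
  by move=> sYU; rewrite setDDr setDv set0U; apply/setIidPr.
have c1 Z : Z \in slice U r.+1 -> weight Z < weight B -> Z != A -> Z \in F.
  move=> Zs lt; apply: contraNT => ZF; apply/eqP.
  have := swap Z B Zs BF (ltnW lt) ZF; rewrite eBA.
  move=> /(congr1 (fun X => U :\: X)); rewrite !compl //.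
    by move: Zs; rewrite in_slice => /andP[].
  by move: As; rewrite in_slice => /andP[].
have c2 Z : Z \in F -> Z != B -> weight Z < weight B.
  move=> ZF; apply: contraNltn => le; apply/eqP.
  by rewrite eBA; apply: swap => //; apply: leq_trans le; apply: ltnW.
(* Below [B] only [A] is missing from [F], and no other member of [F] reaches [B]; so exchanging [B]
   for [A] yields an initial segment. *)
have eI : I = A |: (F :\ B).
  apply: (initial_uniq hI).
    split=> [|Z Y Zs hY le].
      rewrite subUset sub1set As /=; apply: subset_trans sF; exact: subsetDl.
    have ltY : weight Y < weight B.
      by move: hY; rewrite !inE => /orP[/eqP-> //|/andP[ne YF]]; apply: c2.
    have ltZ := leq_ltn_trans le ltY.
    rewrite !inE; case: eqP => //= neZ; rewrite c1 ?andbT //; last exact/eqP.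
    by apply: contraTN ltZ => /eqP->; rewrite ltnn.
  by rewrite cIF cardsU1 !inE (negbTE AF) andbF (cardsD1 B F) BF.
(* A clique [C] of [F] lost in [I] contains [B]. Exchange some [b] of [B] other than [m] for some
   [c] in [C :\: B]. If [b] ranks higher, the result is a member of [F] above [A] other than [B],
   against [swap]; if [c] ranks higher, it is a member of [F] beyond [B], against [c2]. *)
apply/subsetP=> C; rewrite !in_cliques => /and3P[sCU cC /subsetP hC].
rewrite sCU cC; apply/negPn/negP=> /= /subsetPn[B' B's B'I].
have B'B : B' = B.
  by apply/eqP; apply: contraR B'I => ne; rewrite eI !inE ne hC ?orbT.
move: B's; rewrite {B'I}B'B in_slice => /andP[sBC cB].
move: (As); rewrite in_slice => /andP[sAU cA].
have /set0Pn[c] : C :\: B != set0.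
  by rewrite -card_gt0 cardsD (setIidPr sBC) (eqP cB) (eqP cC) subn_gt0.
rewrite inE => /andP[cNB cC'].
have cAm : c \in A by move: cNB; rewrite eBA inE (subsetP sCU) // andbT negbK.
have sub_top x : x \in U -> rk x <= rk m.
  move=> xU; rewrite leqNgt; apply/negP=> /agree.
  by rewrite eBA inE xU andbT; case: (x \in A).
(* If [B] had only the element [m], then [A] would be the singleton of [c], a subset of [C] and
   hence in [F]. *)
have [b bB bm] : exists2 b, b \in B & b != m.
  apply/exists_inP; apply: contraT; rewrite negb_exists_in => /forall_inP h.
  have B1 : B = [set m].
    apply/setP=> x; rewrite inE; apply/idP/eqP => [/h|->//].
    by rewrite negbK => /eqP.
  move: cB; rewrite B1 cards1 => /eqP[r0]; move: cA; rewrite -r0 => /cards1P[a eA].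
  case/negP: AF; apply: hC; rewrite in_slice -r0 eA cards1 eqxx andbT sub1set.
  by move: cAm; rewrite eA inE => /eqP <-.
pose repl x := x |: (B :\ b).
have card_repl x : x \notin B -> #|repl x| == r.+1.
  by move=> xB; rewrite cardsU1 !inE (negbTE xB) andbF /= -(eqP cB) (cardsD1 b B) bB.
have sBU : B \subset U := subset_trans sBC sCU.
have replU x : x \in U -> repl x \subset U.
  by move=> xU; rewrite subUset sub1set xU (subset_trans (subsetDl _ _)).
have ltbc : rk b < rk c.
  rewrite ltnNge leq_eqVlt; apply/negP=> /orP[/eqP/rk_inj e|ltcb].
    by rewrite e bB in cNB.
  have bN : b \notin repl c by rewrite !inE eqxx orbF; apply: contraTneq ltcb => ->; rewrite ltnn.
  have mR : m \in repl c by rewrite !inE mB (eq_sym m b) bm orbT.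
  have ltR : weight (repl c) < weight B.
    apply: (weight_lt rk_inj bB bN) => x ltx; rewrite !inE.
    case: (eqVneq x c) => [e|_]; first by rewrite e in ltx; have := ltn_trans ltx ltcb; rewrite ltnn.
    by case: (eqVneq x b) => [e|//]; rewrite e ltnn in ltx.
  have Rs : repl c \in slice U r.+1 by rewrite in_slice replU ?card_repl // (subsetP sAU).
  have RA : repl c != A by apply: contraNneq mA => <-.
  have RF := c1 _ Rs ltR RA.
  have leAR : weight A <= weight (repl c).
    apply: ltnW; apply: (weight_lt rk_inj mR mA) => x ltx.
    have xU : x \notin U by apply: contraTN ltx => /sub_top; rewrite -leqNgt.
    have out (Y : {set V}) : Y \subset U -> (x \in Y) = false.
      by move=> sYU; apply: contraNF xU; apply: (subsetP sYU).
    by rewrite !out ?replU // (subsetP sAU).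
  by have := swap A _ As RF leAR AF; rewrite -eBA => e; rewrite e bB in bN.
have RC : repl c \subset C.
  by rewrite subUset sub1set cC' (subset_trans (subsetDl _ _)).
have RF : repl c \in F by apply: hC; rewrite in_slice RC card_repl.
have := c2 _ RF; rewrite ltnNge.
have -> : weight B <= weight (repl c).
  apply: ltnW; apply: (@weight_lt _ _ rk_inj _ _ c) => //; first by rewrite setU11.
  move=> x ltx; rewrite !inE; case: (eqVneq x c) => [e|_]; first by rewrite e ltnn in ltx.
  by case: (eqVneq x b) => [e|//]; rewrite e in ltx; have := ltn_trans ltx ltbc; rewrite ltnn.
move=> h; suff: false by []; apply: h; apply: contraNneq cNB => <-.
by rewrite setU11.
Qed.

(** Induction on [#|U|], then on the total weight of [F]. A compression at [i] replaces deletion and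
    link by initial segments, which lowers the weight unless nothing changes; once no vertex of [U]
    changes anything, [stable_cliques] applies. *)
Theorem kruskal_katona U r j F I :
  F \subset slice U r -> initial U r I -> #|I| = #|F| ->
  #|cliques U r j F| <= #|cliques U r j I|.
Proof.
elim: {U}_.+1 {-2}U (ltnSn #|U|) r j F I => // n IHn U leU.
case=> [|r] j F I sF hI cIF.
  suff hF : initial U 0 F by rewrite (initial_uniq hI hF cIF).
  have e0 X : X \in slice U 0 -> X = set0 by rewrite in_slice cards_eq0 => /andP[_ /eqP].
  by split=> // A B As BF _; rewrite (e0 A As) -(e0 B) // (subsetP sF).
have sI : I \subset slice U r.+1 by case: hI.
case: (ltngtP j r.+1) => [ltjr|ltrj|->]; first by rewrite !cliques_lt.
  2: by rewrite !cliques_diag ?cIF.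
elim: {F}_.+1 {-2}F (ltnSn (\sum_(A in F) weight A)) => // w IHw F leF in sF cIF *.
have [p hp] : exists p : V -> {set {set V}} * {set {set V}}, forall i,
    [/\ initial (U :\ i) r.+1 (p i).1, #|(p i).1| = #|deletion i F|,
        initial (U :\ i) r (p i).2 & #|(p i).2| = #|link i F|].
  apply: (fin_all_exists (P := fun i p => [/\ initial (U :\ i) r.+1 p.1,
    #|p.1| = #|deletion i F|, initial (U :\ i) r p.2 & #|p.2| = #|link i F|])) => i.
  have [I0 h0 c0] := ex_initial rk_inj (sub_slice_card (deletion_sub i sF)).
  have [I1 h1 c1] := ex_initial rk_inj (sub_slice_card (link_sub i sF)).
  by exists (I0, I1).
case: (boolP [forall i in U, (deletion i F == (p i).1) && (link i F == (p i).2)]).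
  move=> /forall_inP h; apply: subset_leq_card; apply: stable_cliques => // i iU;
    by have [? ? ? ?] := hp i; have /andP[/eqP e0 /eqP e1] := h i iU; rewrite ?e0 ?e1.
rewrite negb_forall_in => /exists_inP[i iU ne].
have [h0 c0 h1 c1] := hp i.
set I0 := (p i).1 in h0 c0 ne; set I1 := (p i).2 in h1 c1 ne.
have s0 : I0 \subset slice (U :\ i) r.+1 by case: h0.
have s1 : I1 \subset slice (U :\ i) r by case: h1.
have ltUi : #|U :\ i| < n by move: leU; rewrite (cardsD1 i U) iU.
have sG := glue_sub iU s0 s1; have dG := deletion_glue I1 s0; have lG := link_glue I0 s1.
set G := glue i I0 I1 in sG dG lG.
have cG : #|G| = #|F| by rewrite (card_deletion_link i) dG lG c0 c1 -card_deletion_link.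
case: j ltrj IHw => // j ltrj IHw.
apply: (@leq_trans #|cliques U r.+1 j.+1 G|); last first.
  apply: IHw; rewrite ?cG //.
  have w0 : \sum_(A in I0) weight A <= \sum_(A in deletion i F) weight A
      ?= iff (deletion i F == I0).
    apply/leqifP; case: (eqVneq (deletion i F) I0) => [->|ne0]; first exact: eqxx.
    exact: (initial_sum_lt h0 (deletion_sub i sF) c0 ne0).
  have w1 : \sum_(A in I1) weight A <= \sum_(A in link i F) weight A ?= iff (link i F == I1).
    apply/leqifP; case: (eqVneq (link i F) I1) => [->|ne1]; first exact: eqxx.
    exact: (initial_sum_lt h1 (link_sub i sF) c1 ne1).
  have sumU1 J : J \subset slice (U :\ i) r ->
      \sum_(A in J) weight (i |: A) = #|J| * 2 ^ rk i + \sum_(A in J) weight A.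
    move=> /subsetP sJ; rewrite -sum_nat_const -big_split /=; apply: eq_bigr => A /sJ.
    by rewrite in_slice subsetD1 => /andP[/andP[_ iA] _]; rewrite weightU1.
  rewrite ltnS in leF; apply: leq_trans leF.
  rewrite (sum_deletion_link i G) (sum_deletion_link i F) dG lG !sumU1 ?link_sub // c1.
  rewrite !(addnCA _ (_ * _)) ltn_add2l ltn_neqAle.
  by have := leqif_add w0 w1; case=> -> ->; rewrite ne.
rewrite (card_deletion_link i (cliques U _ _ F)) (card_deletion_link i (cliques U _ _ G)).
rewrite !deletion_cliques !link_cliques // dG lG; apply: leq_add.
  exact: (IHn _ ltUi _ _ _ _ (deletion_sub i sF) h0 c0).
have n0 := initial_cliques rk_inj j h0; have n1 := initial_cliques rk_inj j h1.
have k0 := IHn _ ltUi r.+1 j _ _ (deletion_sub i sF) h0 c0.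
have k1 := IHn _ ltUi r j _ _ (link_sub i sF) h1 c1.
(* After the compression the two families whose intersection gives the cliques through [i] are
   initial segments, hence nested. The intersection is the smaller one, and [k0] or [k1] bounds its
   size from below. *)
case: (leqP #|cliques (U :\ i) r.+1 j I0| #|cliques (U :\ i) r j I1|) => le.
  have /setIidPl -> := initial_nested n0 n1 le.
  by apply: leq_trans k0; rewrite subset_leq_card ?subsetIl.
have /setIidPr -> := initial_nested n1 n0 (ltnW le).
by apply: leq_trans k1; rewrite subset_leq_card ?subsetIr.
Qed.

End KruskalKatona.

(** * Economical covers by cliques *)

(* For m >= T, the number of edges of a union of T-cliques on m vertices which
   are pairwise disjoint, except that two of them overlap when T does not
   divide m. *)
Definition cover_size (T l m : nat) : nat :=
  (m %/ T) * 'C(T, l) + ('C(T, l) - 'C(T - m %% T, l)).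

Lemma bin_convex l a x y : 'C(a + x, l) + 'C(a + y, l) <= 'C(a + x + y, l) + 'C(a, l).
Proof.
case: l => [|l]; first by rewrite !bin0.
elim: x => [|x IHx]; first by rewrite addn0 addnC.
rewrite addnS addSn !binS.
by have := leq_bin2l l (leq_addr y (a + x)); lia.
Qed.

Lemma cover_size_addT T l m : 0 < T -> cover_size T l (m + T) = cover_size T l m + 'C(T, l).
Proof. by move=> T0; rewrite /cover_size divnDr // divnn T0 modnDr; lia. Qed.

Lemma cover_size_small T l s : s < T -> cover_size T l s = 'C(T, l) - 'C(T - s, l).
Proof. by move=> ltsT; rewrite /cover_size divn_small // modn_small. Qed.

(** [g] stands for the number of new vertices of one more clique. Modulo [T] only the remainder [s]
    matters, and convexity applies with base [T - (s + g)], or with base 0 once [s + g] reaches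
    [T]. *)
Lemma cover_size_add T l m g : 0 < T -> 0 < l -> g <= T ->
  cover_size T l (m + g) <= cover_size T l m + ('C(T, l) - 'C(T - g, l)).
Proof.
move=> T0 l0 leg; rewrite (divn_eq m T) -addnA; move: (m %/ T) (ltn_pmod m T0).
move: (m %% T) => s q ltsT.
have shift n : cover_size T l (q * T + n) = q * 'C(T, l) + cover_size T l n.
  by elim: q => // q IHq; rewrite !mulSn -addnA addnC cover_size_addT // IHq; lia.
rewrite !shift -addnA leq_add2l (cover_size_small l ltsT).
have le1 := leq_bin2l l (leq_subr s T); have le2 := leq_bin2l l (leq_subr g T).
case: (ltnP (s + g) T) => [ltT|leT].
  rewrite cover_size_small //.
  have := bin_convex l (T - (s + g)) g s.
  have -> : T - (s + g) + g = T - s by lia.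
  have -> : T - (s + g) + s = T - g by lia.
  have -> : T - s + s = T by lia.
  by lia.
have -> : s + g = (s + g - T) + T by lia.
rewrite cover_size_addT // cover_size_small; last by lia.
have := bin_convex l 0 (T - s) (T - g); rewrite !add0n bin0n.
have -> : T - (s + g - T) = T - s + (T - g) by lia.
have -> : (l == 0) = false by lia.
have := leq_bin2l l (_ : T - s + (T - g) <= T); lia.
Qed.

Lemma bin_sub_le t l s : s <= t -> 'C(t, l.+1) <= 'C(t - s, l.+1) + s * 'C(t - 1, l).
Proof.
elim: s => [|s IHs] lest; first by rewrite subn0 addn0.
have := IHs (ltnW lest); have -> : t - s = (t - s.+1).+1 by lia.
rewrite binS; have := leq_bin2l l (_ : t - s.+1 <= t - 1); lia.
Qed.

(* l.+2 * cover_size is a degree sum, and 'C(t, l.+1) the minimal degree. *)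
Lemma cover_size_degree t l m :
  4 * (l.+2 * cover_size t.+1 l.+2 m) <=
  4 * (m * 'C(t, l.+1)) + t.+1 ^ 2 * 'C(t - 1, l).
Proof.
rewrite /cover_size; have lts := ltn_pmod m (ltn0Sn t).
rewrite [in X in _ <= 4 * (X * _) + _](divn_eq m t.+1).
move: (m %/ t.+1) (m %% t.+1) lts => q s lts.
have e1 := mul_bin_diag t.+1 l.+1; have e2 := mul_bin_diag (t.+1 - s) l.+1.
have es : (t.+1 - s).-1 = t - s by lia.
rewrite /= in e1; rewrite es in e2.
have := bin_sub_le l (lts : s <= t).
set a := 'C(t, l.+1) in e1 *; set b := 'C(t - s, l.+1) in e2 *.
set c := 'C(t - 1, l).
move=> le.
rewrite mulnDr mulnBr mulnCA -e1 -e2.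
have h1 : t.+1 * a - (t.+1 - s) * b <= s * a + s * (t.+1 - s) * c.
  have : (t.+1 - s) * a <= (t.+1 - s) * (b + s * c) by rewrite leq_mul2l le orbT.
  rewrite !mulnDr mulnBl; nia.
(* This is the source of the factor (t+1)^2/4 in the bound on [n]. *)
have h2 : 4 * (s * (t.+1 - s)) <= t.+1 ^ 2.
  have -> : t.+1 = s + (t.+1 - s) by lia.
  rewrite addKn; exact: nat_AGM2.
have h3 : 4 * (s * (t.+1 - s)) * c <= t.+1 ^ 2 * c by rewrite leq_mul2r h2 orbT.
move: h1 h3; set X := t.+1 * a - _; nia.
Qed.

Section Covers.

Variable V : finType.
Implicit Types (A B C N P Q U X : {set V}) (E F : {set {set V}}).

(** Disjoint cliques away from [P] are peeled off until fewer than 2T vertices remain; then [P] and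
    one T-set containing all the rest suffice, and only these two may overlap. *)
Lemma ex_economical_cover T l N P : 0 < T -> P \subset N -> #|P| = T ->
  exists E, [/\ E \subset slice N l, #|E| <= cover_size T l #|N|, slice P l \subset E
    & forall v, v \in N -> exists Q : {set V},
        [/\ Q \subset N, #|Q| = T, v \in Q & slice Q l \subset E]].
Proof.
move=> T0; elim: {N}_.+1 {-2}N (ltnSn #|N|) => // n IHn N leN sPN cP.
have lePN := subset_leq_card sPN; rewrite cP in lePN.
case: (ltnP #|N| (T + T)) => [lt|ge].
  have cNP : #|N :\: P| = #|N| - T by rewrite cardsD (setIidPr sPN) cP.
  have [||Q [sQ sQN cQ]] := @ex_card_between _ (N :\: P) N T (subsetDl _ _).
    by rewrite cNP; lia.
    by [].
  exists (slice P l :|: slice Q l); split; last 1 first.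
  - move=> v vN; case: (boolP (v \in P)) => vP.
      by exists P; split=> //; apply: subsetUl.
    by exists Q; split=> //; [apply: (subsetP sQ); rewrite inE vP|apply: subsetUr].
  - by rewrite subUset !slice_mono.
  - rewrite cardsU slice_setI !card_slice cP cQ.
    have cPQ : #|P :&: Q| = T - (#|N| - T).
      have e : Q :\: P = N :\: P.
        apply/setP=> x; rewrite !inE; case: (boolP (x \in P)) => //= xP.
        apply/idP/idP => [/(subsetP sQN)//|xN].
        by apply: (subsetP sQ); rewrite inE xP.
      by have := cardsID P Q; rewrite e cNP cQ setIC; lia.
    have -> : cover_size T l #|N| = cover_size T l (#|N| - T) + 'C(T, l).
      by rewrite -cover_size_addT // subnK.
    rewrite cover_size_small; last by lia.
    by rewrite cPQ addnC addnBA // leq_bin2l // leq_subr.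
  exact: subsetUl.
have cNP : #|N :\: P| = #|N| - T by rewrite cardsD (setIidPr sPN) cP.
have [|Q sQ cQ] := @ex_subset_card _ (N :\: P) T; first by lia.
have sQN : Q \subset N := subset_trans sQ (subsetDl _ _).
have cNQ : #|N :\: Q| = #|N| - T by rewrite cardsD (setIidPr sQN) cQ.
have [| |E [sE cE sPE hE]] := IHn (N :\: Q) _ _ cP.
- by rewrite cNQ; lia.
- rewrite subsetD sPN disjoint_sym; apply: disjointWl sQ _.
  by rewrite -setI_eq0 setIDAC setDIl setDv setI0.
exists (E :|: slice Q l); split.
- by rewrite subUset (subset_trans sE) ?slice_mono ?subsetDl.
- apply: leq_trans (leq_card_setU _ _) _; rewrite card_slice cQ.
  have -> : cover_size T l #|N| = cover_size T l (#|N| - T) + 'C(T, l).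
    by rewrite -cover_size_addT // subnK.
  by rewrite leq_add2r -cNQ.
- by apply: subset_trans sPE _; apply: subsetUl.
move=> v vN; case: (boolP (v \in Q)) => vQ.
  by exists Q; split=> //; apply: subsetUr.
have [|Q' [sQ' cQ' vQ' sE']] := hE v; first by rewrite inE vQ.
exists Q'; split=> //; first by rewrite (subset_trans sQ') ?subsetDl.
by rewrite (subset_trans sE') ?subsetUl.
Qed.

(** The cliques of [D] are added one at a time. The l-subsets of [Q] not inside the union so far are
    new edges, and [cover_size_add] shows that they are numerous enough. *)
Lemma cover_size_le T l E (D : {set {set V}}) : 0 < T -> 0 < l ->
  (forall Q, Q \in D -> #|Q| = T /\ slice Q l \subset E) ->
  cover_size T l #|cover D| <= #|E :&: slice (cover D) l|.
Proof.
move=> T0 l0; rewrite /cover -big_enum /=.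
have : {subset enum D <= D} by move=> Q; rewrite mem_enum.
elim: (enum D) => [|Q s IHs] sD hD.
  by rewrite big_nil cards0 cover_size_small // subn0 subnn.
have [cQ sQE] : #|Q| = T /\ slice Q l \subset E by apply: hD; apply: sD; rewrite inE eqxx.
have {}IHs := IHs (fun R Rs => sD R (mem_behead (Rs : R \in behead (Q :: s)))) hD.
rewrite big_cons; set U := \bigcup_(_ <- s) _ in IHs *.
have le1 : #|E :&: slice U l| + #|slice Q l :\: slice U l| <= #|E :&: slice (Q :|: U) l|.
  rewrite -cardsUI; set I := _ :&: (_ :\: _).
  have -> : I = set0.
    by apply/setP=> A; rewrite !inE; case: (A \subset U); case: (_ == l); rewrite ?andbF.
  rewrite cards0 addn0 subset_leq_card // subUset setIS ?slice_mono ?subsetUr //=.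
  rewrite subsetI (subset_trans (subsetDl _ _) sQE).
  by rewrite (subset_trans (subsetDl _ _)) ?slice_mono ?subsetUl.
apply: leq_trans le1; rewrite cardsD slice_setI !card_slice cQ.
have cQU := cardsID U Q; rewrite cQ in cQU.
have -> : #|Q :|: U| = #|U| + #|Q :\: U| by rewrite cardsU cQ; lia.
have leg : #|Q :\: U| <= T by lia.
apply: leq_trans (cover_size_add _ T0 l0 leg) _.
have -> : T - #|Q :\: U| = #|Q :&: U| by lia.
by rewrite leq_add2r.
Qed.

End Covers.

(** * Vertex orders adapted to two nested sets *)

Section RankedInitial.

Variables (V : finType).
Implicit Types (A B X U P N : {set V}).

Lemma ex_rank P N : P \subset N ->
  exists2 rk : V -> nat, injective rk &
    (forall x y, x \in P -> y \notin P -> rk x < rk y) /\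
    (forall x y, x \in N -> y \notin N -> rk x < rk y).
Proof.
(* [c] numbers the layers [P], [N :\: P] and the rest by 0, 1 and 2; each layer gets its own block
   of [#|V|] ranks. *)
move=> sPN; pose c x := (x \notin P) + (x \notin N).
exists (fun x => enum_rank x + c x * #|V|).
  move=> x y /(congr1 (modn^~ #|V|)) /=.
  by rewrite ![_ + _ * _]addnC !modnMDl !modn_small ?ltn_ord // => /ord_inj/enum_rank_inj.
have key x y : c x < c y -> enum_rank x + c x * #|V| < enum_rank y + c y * #|V|.
  move=> lt; apply: (@leq_trans ((c x).+1 * #|V|)); first by rewrite mulSn ltn_add2r ltn_ord.
  by apply: leq_trans (leq_addl _ _); rewrite leq_mul2r lt orbT.
split=> x y xX yX; apply: key; rewrite /c.
  by rewrite (subsetP sPN _ xX) xX yX.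
by rewrite xX yX (contraNN (subsetP sPN y) yX); case: (x \in P).
Qed.

Lemma initial_low (rk : V -> nat) U X r : injective rk -> X \subset U ->
  (forall x y, x \in X -> y \notin X -> rk x < rk y) -> initial rk U r (slice X r).
Proof.
move=> rk_inj sXU low; split=> [|A B As Bs le]; first exact: slice_mono.
case: (eqVneq A B) => [-> //|ne].
have [m [mB mA agree]] := weight_ltP rk_inj le ne.
move: As Bs; rewrite !in_slice => /andP[_ ->] /andP[sBX _]; rewrite andbT.
apply/subsetP=> a aA; apply/negPn/negP=> aX.
have := agree a (low m a (subsetP sBX _ mB) aX); rewrite aA => /esym/(subsetP sBX).
by apply/negP.
Qed.

End RankedInitial.

(** * Isolating a clique *)

Lemma card_le_inj (aT rT : finType) (X : {set aT}) (Y : {set rT}) (f : aT -> rT) :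
  {in X &, injective f} -> (forall x, x \in X -> f x \in Y) -> #|X| <= #|Y|.
Proof.
move=> inj fXY; rewrite -(card_in_imset inj); apply: subset_leq_card.
by apply/subsetP=> _ /imsetP[x xX ->]; apply: fXY.
Qed.

Lemma card_le_fibers (aT rT : finType) (X Y : {set aT}) (f : aT -> rT) :
  (forall y, #|[set x in X | f x == y]| <= #|[set x in Y | f x == y]|) ->
  #|X| <= #|Y|.
Proof.
have sumE (Z : {set aT}) : #|Z| = \sum_y #|[set x in Z | f x == y]|.
  rewrite -sum1_card (partition_big f predT) //=; apply: eq_bigr => y _.
  by rewrite -sum1_card; apply: eq_bigl => x; rewrite inE.
by move=> h; rewrite (sumE X) (sumE Y); apply: leq_sum => y _; apply: h.
Qed.

Section Surgery.

Variable V : finType.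
Implicit Types (A B C N P Q R S U X : {set V}) (E F : {set {set V}}).

Lemma clique_covers l k t Q E (v : V) :
  #|Q| = t.+1 -> v \in Q -> slice Q l \subset E ->
  'C(t, k) <= #|link v (cliques setT l k.+1 E)|.
Proof.
move=> cQ vQ sQE; have cQv : #|Q :\ v| = t by have := cardsD1 v Q; rewrite vQ cQ; lia.
rewrite -cQv -card_slice subset_leq_card //; apply/subsetP=> B.
rewrite in_slice subsetD1 => /andP[/andP[sBQ vB] cB].
rewrite inE vB in_cliques subsetT card_setU1S // cB /=.
by apply: subset_trans sQE; rewrite slice_mono // subUset sub1set vQ.
Qed.

Lemma setDUK U R B : R \subset ~: U -> B \subset U -> (R :|: B) :\: U = R.
Proof.
move=> /subsetP sR /subsetP sB; apply/setP=> x; rewrite !inE.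
have := sR x; have := sB x; rewrite inE.
by case: (x \in U); case: (x \in R); case: (x \in B) => //= h1 h2;
  rewrite ?(h1 isT) ?(h2 isT).
Qed.

Lemma setIUK U R B : R \subset ~: U -> B \subset U -> (R :|: B) :&: U = B.
Proof.
move=> /subsetP sR /subsetP sB; apply/setP=> x; rewrite !inE.
have := sR x; have := sB x; rewrite inE.
by case: (x \in U); case: (x \in R); case: (x \in B) => //= h1 h2;
  rewrite -?(h1 isT) -?(h2 isT).
Qed.

Lemma cardsUC U R B : R \subset ~: U -> B \subset U -> #|R :|: B| = #|R| + #|B|.
Proof. by move=> sR sB; rewrite -(cardsID U) setIUK // setDUK // addnC. Qed.

Lemma split_inj U R : {in [set X : {set V} | X :\: U == R] &,
  injective (fun X => X :&: U)}.
Proof.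
move=> X Y; rewrite !inE => /eqP eX /eqP eY e.
by rewrite -(setID X U) -(setID Y U) eX eY e.
Qed.

(** [D] stands for the cliques of the tight vertices and [A] for the non-tight vertices of their
    union. The two size conditions let the replaced traces and the clique [P'] fit into
    [U :\: P]. *)
Lemma isolating_surgery l k t E U A (D : {set {set V}}) :
  0 < l < k -> E \subset slice setT l.+1 ->
  (forall v : V, 'C(t, k) <= #|link v (cliques setT l.+1 k.+1 E)|) ->
  U = cover D ->
  (forall Q, Q \in D -> #|Q| = t.+1 /\ slice Q l.+1 \subset E) ->
  (forall e, e \in E -> ~~ (e \subset U) -> e :&: U \subset A) ->
  A \subset U -> #|A| + t.+1 <= #|U| -> t.+1 + t.+1 <= #|U| ->
  exists E' P, [/\ E' \subset slice setT l.+1, #|E'| <= #|E|,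
    forall v : V, 'C(t, k) <= #|link v (cliques setT l.+1 k.+1 E')|,
    #|P| = t.+1 /\ slice P l.+1 \subset E'
    & forall e, e \in E' -> ~ (e :&: P != set0 /\ e :&: ~: P != set0)].
Proof.
move=> /andP[l0 ltlk] sE covE eU hD hA sAU leA leU.
have [P sPU cP] : exists2 P : {set V}, P \subset U & #|P| = t.+1.
  by apply: ex_subset_card; lia.
pose N := U :\: P; have cN : #|N| = #|U| - t.+1 by rewrite cardsD (setIidPr sPU) cP.
have sNU : N \subset U by apply: subsetDl.
have [P' sP'N cP'] : exists2 P' : {set V}, P' \subset N & #|P'| = t.+1.
  by apply: ex_subset_card; lia.
have [EN [sEN cEN sP'E hEN]] := ex_economical_cover l.+1 (ltn0Sn t) sP'N cP'.
have [rk rk_inj [lowP' lowN]] := ex_rank sP'N.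
have sP'U := subset_trans sP'N sNU.
pose L R := [set B : {set V} | [&& R \subset ~: U, B \subset U & R :|: B \in E]].
have sL R : L R \subset slice U (l.+1 - #|R|).
  apply/subsetP=> B; rewrite inE in_slice => /and3P[sR sB /(subsetP sE)].
  by rewrite sB in_slice (@cardsUC U) // => /andP[_ /eqP <-]; rewrite addKn eqxx.
have [I hI] : exists I : {set V} -> {set {set V}}, forall R,
    initial rk U (l.+1 - #|R|) (I R) /\ #|I R| = #|L R|.
  apply: (fin_all_exists (P := fun R J => initial rk U (l.+1 - #|R|) J /\ #|J| = #|L R|)) => R.
  by have [J hJ cJ] := ex_initial rk_inj (sub_slice_card (sL R)); exists J.
have sIN R : R != set0 -> I R \subset slice N (l.+1 - #|R|).
  move=> R0; apply: initial_nested (proj1 (hI R)) (initial_low _ rk_inj sNU lowN) _.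
  rewrite (proj2 (hI R)) card_slice; apply: (@leq_trans 'C(#|A|, l.+1 - #|R|)).
    apply: sub_slice_card; apply/subsetP=> B BL.
    have := subsetP (sL R) _ BL; rewrite !in_slice => /andP[sB ->]; rewrite andbT.
    move: BL; rewrite inE => /and3P[sR _ /hA]; rewrite setIUK //; apply.
    by apply: contra R0; rewrite -setD_eq0 setDUK.
  by apply: leq_bin2l; lia.
pose X := [set e : {set V} | ~~ (e \subset U) && (e :&: U \in I (e :\: U))].
pose E' := slice P l.+1 :|: EN :|: X.
have sPE' : slice P l.+1 \subset E' by rewrite /E' -setUA subsetUl.
have sENE' : EN \subset E' by rewrite /E' -setUA setUCA subsetUl.
have sXE' : X \subset E' by apply: subsetUr.
(* The subtraction in [l.+1 - #|R|] is truncated; a member of [I R] yields one of [L R], which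
   excludes [#|R| > l.+1]. *)
have I_small R B : B \in I R -> #|R| + #|B| = l.+1.
  move=> BI; have : 0 < #|L R| by rewrite -(proj2 (hI R)); apply/card_gt0P; exists B.
  case/card_gt0P=> C; rewrite inE => /and3P[sR sC /(subsetP sE)].
  rewrite in_slice (@cardsUC U) // => /andP[_ cC].
  have := subsetP (proj1 (proj1 (hI R))) _ BI; rewrite in_slice => /andP[_ /eqP->].
  by rewrite subnKC // -(eqP cC) leq_addr.
have sE' : E' \subset slice setT l.+1.
  rewrite !subUset slice_mono ?subsetT // (subset_trans sEN) ?slice_mono ?subsetT //=.
  apply/subsetP=> e; rewrite inE => /andP[_ /I_small].
  by move=> cRB; rewrite in_slice subsetT -(cardsID U e) addnC cRB eqxx.
have leX : #|X| <= #|E :\: slice U l.+1|.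
  apply: (card_le_fibers (f := fun e => e :\: U)) => R.
  case: (set_0Vmem [set x in X | x :\: U == R]) => [->|[e0]]; first by rewrite cards0.
  rewrite !inE -setD_eq0 => /andP[/andP[ne0 _] /eqP eR]; rewrite eR in ne0.
  have sR : R \subset ~: U by rewrite -eR; apply/subsetP=> x; rewrite !inE => /andP[].
  apply: (@leq_trans #|I R|).
    apply: (card_le_inj (f := fun e => e :&: U)) => [e f|e].
      by rewrite !inE => /andP[_ he] /andP[_ hf]; apply: (@split_inj U R); rewrite inE.
    by rewrite !inE => /andP[/andP[_ h] /eqP <-].
  rewrite (proj2 (hI R)); apply: (card_le_inj (f := fun B => R :|: B)) => [B C|B].
    rewrite !inE => /and3P[_ sB _] /and3P[_ sC _] e.
    by rewrite -(setIUK sR sB) e setIUK.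
  rewrite !inE => /and3P[_ sB ->]; rewrite setDUK // eqxx andbT andbT.
  by apply: contra ne0 => /andP[]; rewrite -setD_eq0 setDUK.
exists E', P; split=> //.
(* Inside [U] the old graph has at least [cover_size t.+1 l.+1 #|U|] edges. Taking [t.+1] vertices
   away lowers this number by exactly the edge count of [P]. *)
- have cU := cover_size_le (ltn0Sn t) (ltn0Sn l) hD; rewrite -eU in cU.
  rewrite -(cardsID (slice U l.+1) E); apply: leq_trans (leq_card_setU _ _) _.
  apply: leq_add leX; apply: leq_trans (leq_card_setU _ _) _; apply: leq_trans cU.
  rewrite -(@subnK t.+1 #|U|); last exact: leq_trans (leq_addr _ _) leU.
  by rewrite cover_size_addT // card_slice cP addnC leq_add2r -cN.
- move=> w; case: (boolP (w \in U)) => wU.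
    case: (boolP (w \in P)) => wP; first exact: clique_covers cP wP sPE'.
    have [|Q [_ cQ wQ sQ]] := hEN w; first by rewrite inE wP.
    exact: clique_covers cQ wQ (subset_trans sQ sENE').
  have w1 : [set w] \subset ~: U by rewrite sub1set inE.
  have w0 : [set w] != set0 by apply/set0Pn; exists w; rewrite inE.
  have [hw cw] := hI [set w]; rewrite cards1 subn1 /= in hw.
  have lowI := initial_low l rk_inj sP'U lowP'.
  have P'E' : slice P' l.+1 \subset E' := subset_trans sP'E sENE'.
  (* In the first case [w] is joined to every l-subset of [P'], so each k-subset of [P'] gives a
     clique through [w]. *)
  case: (leqP #|slice P' l| #|I [set w]|) => [leI|/ltnW geI].
    have sPI := initial_nested lowI hw leI.
    apply: (@leq_trans #|slice P' k|).
      by rewrite card_slice cP'; apply: leq_bin2l.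
    apply: subset_leq_card; apply/subsetP=> B; rewrite in_slice => /andP[sB cB].
    have wB : w \notin B by apply: contra wU => /(subsetP sB)/(subsetP sP'U).
    rewrite inE wB in_cliques subsetT card_setU1S // cB /=.
    apply/subsetP=> e; rewrite in_slice => /andP[se ce].
    case: (boolP (w \in e)) => we; last first.
      apply: (subsetP P'E'); rewrite in_slice ce andbT.
      apply: subset_trans sB; apply/subsetP=> x xe.
      have := subsetP se _ xe; rewrite in_setU1; case: eqP => // ex.
      by rewrite -ex xe in we.
    have seP : e :\ w \subset P' by apply: subset_trans sB; rewrite subDset.
    have ew : [set w] :|: (e :\ w) = e by rewrite setD1K.
    apply: (subsetP sXE'); rewrite inE -ew setDUK ?setIUK ?(subset_trans seP) //.
    apply/andP; split; first by rewrite subUset sub1set (negbTE wU).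
    by apply: (subsetP sPI); rewrite in_slice seP; move: ce; rewrite (cardsD1 w e) we.
  have sIP := initial_nested hw lowI geI.
  apply: leq_trans (covE w) _; rewrite !card_link.
  apply: (card_le_fibers (f := fun K => K :\: U)) => R.
  case: (set_0Vmem [set x in [set K in cliques setT l.+1 k.+1 E | w \in K] | x :\: U == R]).
    by move=> ->; rewrite cards0.
  move=> [K0]; rewrite inE inE in_cliques => /andP[/andP[/and3P[_ cK0 _] wK0] /eqP eR].
  have sR : R \subset ~: U by rewrite -eR; apply/subsetP=> x; rewrite !inE => /andP[].
  have wR : w \in R by rewrite -eR inE wU.
  pose j := #|K0 :&: U|.
  have cR : #|R| + j = k.+1 by rewrite -(eqP cK0) -(cardsID U K0) eR addnC.
  (* The possible nonempty outer parts of edges in a clique with outer part [R]; size [l.+1]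
     accounts for the edges that avoid [U]. *)
  pose cand S := [&& S \subset R, S != set0 & #|S| <= l.+1].
  have candw : cand [set w] by rewrite /cand sub1set wR w0 cards1.
  pose M S := cliques U (l.+1 - #|S|) j (I S).
  have hM S : initial rk U j (M S) := initial_cliques rk_inj j (proj1 (hI S)).
  (* The [M S] are nested, so the smallest one, [M S0], lies in all others. Its members meet the
     conditions for all [S] at once, and Kruskal-Katona is applied to [S0] alone. *)
  case: (@arg_minnP _ [set w] cand (fun S => #|M S|) candw) => S0 cS0 minS0.
  have sM S : cand S -> M S0 \subset M S.
    by move=> cS; apply: initial_nested (hM S0) (hM S) (minS0 S cS).
  apply: (@leq_trans #|cliques U (l.+1 - #|S0|) j (L S0)|).
    apply: (card_le_inj (f := fun e => e :&: U)) => [e f|K].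
      by rewrite !inE => /andP[_ he] /andP[_ hf]; apply: (@split_inj U R); rewrite inE.
    rewrite inE inE !in_cliques => /andP[/andP[/and3P[_ cK /subsetP hK] wK] /eqP eKR].
    rewrite subsetIr /=; apply/andP; split.
      have := cardsID U K; rewrite eKR (eqP cK) -cR addnC => /eqP.
      by rewrite eqn_add2l.
    case/and3P: cS0 => sS0 _ leS0; have sS0U := subset_trans sS0 sR.
    apply/subsetP=> B; rewrite in_slice => /andP[sB cB].
    have sBU := subset_trans sB (subsetIr _ _).
    rewrite inE sS0U sBU /=; apply: hK; rewrite in_slice (@cardsUC U) // (eqP cB) subnKC // eqxx.
    rewrite andbT subUset (subset_trans sB (subsetIl _ _)) andbT.
    by apply: subset_trans sS0 _; rewrite -eKR subsetDl.
  apply: (@leq_trans #|M S0|).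
    exact (kruskal_katona rk_inj j (sL S0) (proj1 (hI S0)) (proj2 (hI S0))).
  apply: (card_le_inj (f := fun C => R :|: C)) => [B C|C CM].
    rewrite !in_cliques => /and3P[sB _ _] /and3P[sC _ _] e.
    by rewrite -(setIUK sR sB) e setIUK.
  have [sCU cC] : C \subset U /\ #|C| = j.
    by move: CM; rewrite in_cliques => /and3P[? /eqP ? _].
  rewrite inE inE setDUK // eqxx in_setU wR !andbT in_cliques subsetT (@cardsUC U) // cC cR eqxx /=.
  apply/subsetP=> e; rewrite in_slice => /andP[se ce].
  have seC : e :&: U \subset C by rewrite -(setIUK sR sCU) setSI.
  have seR : e :\: U \subset R by rewrite -(setDUK sR sCU) setSD.
  have ceU := cardsID U e; rewrite (eqP ce) in ceU.
  (* For an edge inside [U]: the l-subsets of [C] belong to [I [set w]] and so lie in [P'], which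
     puts [e] inside the clique [P']. *)
  case: (eqVneq (e :\: U) set0) => [e0|ne0].
    have seU : e \subset U by rewrite -setD_eq0 e0.
    apply: (subsetP P'E'); rewrite in_slice ce andbT.
    apply: (@slice_subset _ _ _ l); first by rewrite (eqP ce) l0 /=.
    apply: subset_trans sIP; have := subsetP (sM _ candw) _ CM.
    rewrite in_cliques cards1 subn1 => /and3P[_ _]; apply: subset_trans.
    by apply: slice_mono; rewrite (setIidPl seU) in seC.
  apply: (subsetP sXE'); rewrite inE -setD_eq0 ne0 /=.
  have cS : cand (e :\: U) by rewrite /cand seR ne0 -ceU leq_addl.
  have := subsetP (sM _ cS) _ CM; rewrite in_cliques => /and3P[_ _ /subsetP]; apply.
  by rewrite in_slice seC; rewrite -ceU addnK eqxx.
- move=> e; rewrite !in_setU => eE' [/set0Pn[x] + /set0Pn[y]].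
  rewrite !inE => /andP[xe xP] /andP[ye yP].
  case/orP: eE' => [/orP[]|].
  + by rewrite in_slice => /andP[/subsetP/(_ _ ye)]; rewrite (negbTE yP).
  + move=> /(subsetP sEN); rewrite in_slice => /andP[/subsetP/(_ _ xe)].
    by rewrite inE xP.
  rewrite inE -setD_eq0 => /andP[ne0 /(subsetP (sIN _ ne0))].
  rewrite in_slice => /andP[/subsetP/(_ x)]; rewrite !inE xe xP (subsetP sPU) //=.
  by move=> /(_ isT).
Qed.

End Surgery.

(** * Tight vertices and the conclusion *)

(** The predicate used later quantifies over all finite types, so the descent decides by excluded
    middle whether a smaller witness exists. *)
Lemma ex_minimal (P : nat -> Prop) : (exists m, P m) ->
  exists2 m, P m & forall n, P n -> m <= n.
Proof.
case=> m; elim/ltn_ind: m => m IHm Pm.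
have [[n [ltnm Pn]]|no] := classic (exists n, n < m /\ P n); first exact: IHm Pn.
exists m => // n Pn; rewrite leqNgt; apply/negP=> lt; apply: no.
by exists n.
Qed.

Section Tight.

Variable V : finType.
Implicit Types (A B C N P Q R S U X : {set V}) (E F : {set {set V}}).

(** Each non-tight vertex adds at least 1 to the degree sum beyond the minimum, while
    [cover_size_degree] bounds that sum from above. *)
Lemma card_not_tight t l E : E \subset slice setT l.+2 ->
  #|E| <= cover_size t.+1 l.+2 #|V| ->
  (forall v : V, 'C(t, l.+1) <= #|link v E|) ->
  4 * #|[set v | #|link v E| != 'C(t, l.+1)]| <= t.+1 ^ 2 * 'C(t - 1, l).
Proof.
move=> sE leE degE; set B := [set v | _].
have sumE : \sum_v #|link v E| = l.+2 * #|E|.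
  rewrite -(sum_card_link sE); apply: eq_bigl => v; by rewrite inE.
have : #|V| * 'C(t, l.+1) + #|B| <= l.+2 * #|E|.
  rewrite -sumE -sum_nat_const -sum1_card [\sum_(_ in B) _]big_mkcond -big_split /=.
  apply: leq_sum => v _; rewrite inE; have := degE v; case: eqP => [->|/eqP ne] /=.
    by rewrite addn0.
  by rewrite leq_eqVlt eq_sym (negbTE ne) /= addn1.
have := cover_size_degree t l #|V|.
have : l.+2 * #|E| <= l.+2 * cover_size t.+1 l.+2 #|V| by rewrite leq_mul2l leE.
by move: (l.+2 * _) (l.+2 * _) (#|V| * _) (_ * 'C(t - 1, l)) => a b c d; lia.
Qed.

Lemma ex_isolated l k t E :
  l.+1 < k <= t -> E \subset slice setT l.+2 ->
  (forall v : V, 'C(t, k) <= #|link v (cliques setT l.+2 k.+1 E)|) ->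
  #|E| <= cover_size t.+1 l.+2 #|V| ->
  t.+1 ^ 2 * 'C(t - 1, l) + 8 * t < 4 * #|V| ->
  exists E' P, [/\ E' \subset slice setT l.+2, #|E'| <= #|E|,
    forall v : V, 'C(t, k) <= #|link v (cliques setT l.+2 k.+1 E')|,
    #|P| = t.+1 /\ slice P l.+2 \subset E'
    & forall e, e \in E' -> ~ (e :&: P != set0 /\ e :&: ~: P != set0)].
Proof.
move=> /andP[ltlk lekt] sE covE leE ltV.
have l0k : 0 < l.+1 < k by [].
have bound v := link_cliques_bound l0k lekt sE (covE v).
pose T0 := [set v | #|link v E| == 'C(t, l.+1)].
have cT0 : t + t < #|T0|.
  have := card_not_tight sE leE (fun v => proj1 (bound v)).
  have -> : [set v | #|link v E| != 'C(t, l.+1)] = ~: T0 by apply/setP=> v; rewrite !inE.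
  have := cardsC T0; move: ltV; move: (_ * 'C(_, _)) => c; lia.
pose owns v Q := [&& v \in Q, #|Q| == t.+1, slice Q l.+2 \subset E
  & [forall e in E, (v \in e) ==> (e \subset Q)]].
pose D := [set Q | [exists v in T0, owns v Q]].
have ownD v : v \in T0 -> exists2 Q, Q \in D & owns v Q.
  move=> vT; have [_] := bound v; move: (vT); rewrite inE => /eqP ev /(_ ev).
  case=> Q [vQ cQ sQ hQ]; have oQ : owns v Q.
    rewrite /owns vQ cQ sQ eqxx; apply/forall_inP => e eE.
    by apply/implyP; apply: hQ.
  by exists Q => //; rewrite inE; apply/exists_inP; exists v.
have hD Q : Q \in D -> #|Q| = t.+1 /\ slice Q l.+2 \subset E.
  by rewrite inE => /exists_inP[v _ /and4P[_ /eqP-> ->]].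
have ownE v Q e : owns v Q -> e \in E -> v \in e -> e \subset Q.
  by case/and4P=> _ _ _ /forall_inP h eE; apply/implyP; apply: h.
have sDU Q : Q \in D -> Q \subset cover D by move=> QD; apply: (bigcup_sup Q).
have sT0 : T0 \subset cover D.
  apply/subsetP=> v /ownD[Q QD /and4P[vQ _ _ _]].
  exact: (subsetP (sDU Q QD)).
have cA : #|cover D :\: T0| = #|cover D| - #|T0| by rewrite cardsD (setIidPr sT0).
have leT0 := subset_leq_card sT0.
case: (set_0Vmem (cover D :\: T0)) => [A0|[a aA]]; last first.
  have ltT0 : 0 < #|cover D :\: T0| by apply/card_gt0P; exists a.
  apply: (@isolating_surgery V l.+1 k t E (cover D) (cover D :\: T0) D) => //.
  (* An edge through a tight vertex lies in the clique of that vertex, hence in the union; so an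
     edge leaving the union meets it in non-tight vertices only. *)
  - move=> e eE eU; apply/subsetP=> x; rewrite in_setI => /andP[xe xU].
    rewrite in_setD xU andbT; apply: contra eU => /ownD[Q QD oQ].
    by apply: subset_trans (sDU Q QD); apply: ownE oQ eE xe.
  - exact: subsetDl.
  - by rewrite cA; clear -cT0 leT0; lia.
  (* At least 2t+1 tight vertices and the non-tight [a] make 2(t+1). *)
  - by clear -cA cT0 leT0 ltT0; lia.
have [v0 v0T] : exists v, v \in T0 by apply/card_gt0P; clear -cT0; lia.
have [Q QD _] := ownD v0 v0T; have [cQ sQE] := hD Q QD.
exists E, Q; split=> // e eE [/set0Pn[x] + /set0Pn[y]].
rewrite !inE => /andP[xe xQ] /andP[ye]; apply/negP; rewrite negbK.
have xT : x \in T0.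
  apply: contraT => xN; have : x \in cover D :\: T0.
    by rewrite in_setD xN (subsetP (sDU Q QD)).
  by rewrite A0 inE.
have [Q' Q'D oQ'] := ownD x xT; have [cQ' _] := hD Q' Q'D.
(* Any [z] in [Q] shares with [x] an edge inside [Q]; as [x] is tight, that edge lies in its clique
   [Q']. *)
suff sQQ' : Q \subset Q'.
  have -> : Q = Q' by apply/eqP; rewrite eqEcard sQQ' cQ cQ' leqnn.
  by apply: subsetP ye; apply: ownE oQ' eE xe.
apply/subsetP=> z zQ.
have [|||f [sf sfQ cf]] := @ex_card_between V [set x; z] Q l.+2.
- by rewrite subUset !sub1set xQ zQ.
- by rewrite cards2; case: (_ != _).
- by rewrite cQ; clear -ltlk lekt; lia.
have fE : f \in E by apply: (subsetP sQE); rewrite in_slice sfQ cf eqxx.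
have xf : x \in f by apply: (subsetP sf); rewrite !inE eqxx.
have zf : z \in f by apply: (subsetP sf); rewrite !inE eqxx orbT.
exact: subsetP (ownE _ _ _ oQ' fE xf) z zf.
Qed.

End Tight.

(** * From graphs to set families, and the theorem *)

Lemma edges_sub l (V : finType) (G : lgraph l V) : edges G \subset slice setT l.
Proof. by apply/subsetP=> e /edges_card ce; rewrite in_slice subsetT ce eqxx. Qed.

Lemma is_copyE l (V : finType) (G : lgraph l V) s S :
  is_copy G s S = (S \in cliques setT l s (edges G)).
Proof.
rewrite in_cliques subsetT; congr (_ && _); apply/forallP/subsetP => h e.
  by rewrite in_slice => he; move: (h e); rewrite he.
by apply/implyP=> he; apply: h; rewrite in_slice.
Qed.

Lemma card_copies_at l (V : finType) (G : lgraph l V) s (v : V) :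
  #|copies_at G s v| = #|link v (cliques setT l s (edges G))|.
Proof.
rewrite card_link; apply: eq_card => S; rewrite /copies_at.
by rewrite in_set is_copyE [in RHS]in_set.
Qed.

Definition lgraph_of l (V : finType) (E : {set {set V}})
    (sE : E \subset slice setT l) : lgraph l V.
Proof.
exists E => e eE; apply/eqP.
by have := subsetP sE e eE; rewrite in_slice => /andP[].
Defined.

Import Order.TTheory GRing.Theory Num.Theory.

Lemma order_bound_nat (t n c : nat) :
  (1 / 4%:R * t.+1%:R ^+ 2 * c%:R + 2%:R * t%:R < n%:R :> rat)%R ->
  t.+1 ^ 2 * c + 8 * t < 4 * n.
Proof.
rewrite expr2 => h; rewrite -(ltr_nat rat) natrD !natrM.
by move: (t.+1%:R)%R (c%:R)%R (t%:R)%R (n%:R)%R h => a b x y; lra.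
Qed.

Theorem theorem9 (k l : nat) (hl : 2 <= l) (hkl : l < k) :
  exists t0 : nat, forall t n : nat, t0 <= t ->
    (1 / 4%:R * t.+1%:R ^+ 2 * 'C(t - 1, l - 2)%:R + 2%:R * t%:R
       < n%:R :> rat)%R ->
    exists (V : finType) (G : lgraph l V),
      extremal k t n G /\ exists S : {set V}, isolated_copy G t.+1 S.
Proof.
(* With threshold [k], the cliques counted in links, of size [k - 1], have size at most [t], as the
   clique bounds require. *)
exists k => t n lekt /order_bound_nat ltn.
case: l hl hkl ltn => [|[|l]] // _; case: k lekt => // k lekt hkl.
rewrite subSS subSS subn0 => ltn.
have kE : k.+1 - 1 = k by rewrite subSS subn0.
have ltTn : t < n by move: ltn; move: (_ * 'C(_, _)) => c; clear; lia.
(* An extremal graph is found by minimising over attained edge numbers; the economical cover shows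
   that there is one and bounds the minimum by [cover_size]. *)
pose attained m := exists (V : finType) (G : lgraph l.+2 V),
  [/\ #|V| = n, covered k.+1 t G & #|edges G| = m].
have [m0 le_m0 attained_m0] : exists2 m, m <= cover_size t.+1 l.+2 n & attained m.
  have [P sP cP] : exists2 P : {set 'I_n}, P \subset setT & #|P| = t.+1.
    by apply: ex_subset_card; rewrite cardsT card_ord.
  have [E [sE leE _ hE]] := ex_economical_cover l.+2 (ltn0Sn t) sP cP.
  rewrite cardsT card_ord in leE.
  exists #|E| => //; exists 'I_n, (lgraph_of sE); split=> //; first exact: card_ord.
  move=> v; have [|Q [_ cQ vQ sQ]] := hE v; first by rewrite inE.
  by rewrite card_copies_at kE; apply: clique_covers cQ vQ sQ.
have [m [V [G [cV covG cG]]] minm] := ex_minimal (ex_intro _ m0 attained_m0).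
have covE v : 'C(t, k) <= #|link v (cliques setT l.+2 k.+1 (edges G))|.
  by have := covG v; rewrite card_copies_at kE.
have hkt : l.+1 < k <= t by rewrite -ltnS hkl ltnW.
have [||E [P [sE leE covE' [cP sPE] isoP]]] := ex_isolated hkt (edges_sub G) covE.
- by rewrite cG cV; apply: leq_trans (minm _ attained_m0) le_m0.
- by rewrite cV.
exists V, (lgraph_of sE); split.
  split=> // [v|W H cW covH]; first by rewrite card_copies_at kE.
  by apply: leq_trans leE _; rewrite cG; apply: minm; exists W, H.
exists P; split; last exact: isoP.
by rewrite is_copyE in_cliques subsetT cP eqxx.
Qed.
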